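(* Let $\Gamma$ be a finitely generated group. Let $G$ be a semisimple subgroup of the special linear group $SL_n(\mathbb{R})$. Let $K$ be a semisimple subgroup of $G$ and let $\rho_0:\Gamma\to G$ be a representation of $\Gamma$ such that the Zariski closure of $\rho_0(\Gamma)$ is $K$. Let $\{H_1,\ldots,H_r\}$ represent a finite set of conjugacy classes of proper reductive subgroups of $G$. Suppose $\operatorname{rank} H_i<\operatorname{rank} K$ for all $1\le i\le r$. Then there exists $\gamma\in\Gamma$ such that $\rho_0(\gamma)\notin gH_ig^{-1}$ for all $g\in G$ and all $1\le i\le r$.
   Context: Algebraic groups are linear algebraic groups over $\mathbb{R}$. The rank of a reductive group is its reductive rank, i.e. the dimension of a maximal torus (of the complexification). *)

(* Defs.v *)
From mathcomp Require Import all_boot all_order all_algebra.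
From mathcomp Require Import boolp classical_sets reals complex.
From mathcomp Require mpoly.

Set Implicit Arguments.
Unset Strict Implicit.
Unset Printing Implicit Defensive.

Import GRing.Theory.
Local Open Scope classical_set_scope.
Local Open Scope ring_scope.

Definition finitely_generated (Gamma : groupType) : Prop :=
  exists s : seq Gamma,
    smallest (fun P : set Gamma =>
        [/\ P 1%g, forall x y, P x -> P y -> P (x * y)%g
          & forall x, P x -> P (x^-1)%g]) [set` s] = setT.

Section MatrixGroups.
Variable F : fieldType.

(** Polynomials on ['M_n] are polynomials in the [n * n] matrix entries, listed
    in the order of [mxvec]. *)
Definition peval n (p : mpoly.mpoly (n * n) F) (A : 'M[F]_n) : F :=
  mpoly.meval (fun k => mxvec A 0 k) p.

(** The closure is taken in ['M_n]; as [SL_n] is closed in ['M_n], it is also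
    the closure in [SL_n] of a subset of [SL_n]. *)
Definition zariski_closure n (S : set 'M[F]_n) : set 'M[F]_n :=
  [set A | forall p, (forall B, S B -> peval p B = 0) -> peval p A = 0].

Definition zariski_closed n (S : set 'M[F]_n) : Prop := zariski_closure S = S.

Definition zariski_connected n (S : set 'M[F]_n) : Prop :=
  forall Y Z : set 'M[F]_n, zariski_closed Y -> zariski_closed Z ->
    S `<=` Y `|` Z -> S `&` Y `&` Z = set0 ->
    S `&` Y = set0 \/ S `&` Z = set0.

Definition SL n : set 'M[F]_n := [set A | \det A = 1].

Definition matrix_group n (S : set 'M[F]_n) : Prop :=
  [/\ S `<=` [set A | A \in unitmx], S 1%:M,
      forall A B, S A -> S B -> S (A *m B)
    & forall A, S A -> S (invmx A)].

Definition algebraic_group n (G : set 'M[F]_n) : Prop :=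
  [/\ G `<=` @SL n, matrix_group G & zariski_closed G].

Definition conj_by n (g A : 'M[F]_n) : 'M[F]_n := g *m A *m invmx g.

Definition normal_in n (N G : set 'M[F]_n) : Prop :=
  N `<=` G /\ forall g A, G g -> N A -> N (conj_by g A).

Definition derived_group n (G : set 'M[F]_n) : set 'M[F]_n :=
  smallest (@matrix_group n)
    [set A *m B *m invmx A *m invmx B | A in G & B in G].

Definition solvable_group n (G : set 'M[F]_n) : Prop :=
  exists k : nat, iter k (@derived_group n) G = [set 1%:M].

Definition unipotent n (A : 'M[F]_n) : Prop :=
  exists k : nat, (A - 1%:M) ^+ k = 0.

Definition unipotent_group n (G : set 'M[F]_n) : Prop :=
  G `<=` @unipotent n.

(** [N] is the largest closed connected normal subgroup of [G] with property
    [P]. *)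
Definition largest_connected_normal n (P : set 'M[F]_n -> Prop)
    (G N : set 'M[F]_n) : Prop :=
  let C M := [/\ algebraic_group M, zariski_connected M, normal_in M G & P M] in
  C N /\ forall M, C M -> M `<=` N.

Definition is_radical n (G N : set 'M[F]_n) : Prop :=
  largest_connected_normal (@solvable_group n) G N.

Definition is_unipotent_radical n (G N : set 'M[F]_n) : Prop :=
  largest_connected_normal (@unipotent_group n) G N.

Definition polynomial_map m n (f : 'M[F]_m -> 'M[F]_n) : Prop :=
  exists P : 'I_n -> 'I_n -> mpoly.mpoly (m * m) F,
    forall A i j, f A i j = peval (P i j) A.

Definition algebraic_iso m n (G : set 'M[F]_m) (H : set 'M[F]_n) : Prop :=
  exists f : 'M[F]_m -> 'M[F]_n, exists g : 'M[F]_n -> 'M[F]_m,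
    [/\ polynomial_map f, polynomial_map g,
        forall A, G A -> H (f A) /\ g (f A) = A,
        forall B, H B -> G (g B) /\ f (g B) = B
      & forall A B, G A -> G B -> f (A *m B) = f A *m f B].

(** The [d]-th power of the multiplicative group, embedded as the closed
    subgroup of matrices [diag (t_1, .., t_d, 1/t_1, .., 1/t_d)] of [SL_(2d)];
    the inverses make every regular function the restriction of a polynomial
    in the entries. *)
Definition Gm_power d : set 'M[F]_(d + d) :=
  [set A | exists t : 'rV[F]_d, (forall i, t 0 i != 0) /\
     A = diag_mx (row_mx t (map_mx (fun x => x^-1) t))].

Definition torus_of_dim n (d : nat) (T : set 'M[F]_n) : Prop :=
  algebraic_group T /\ algebraic_iso (@Gm_power d) T.

Definition torus n (T : set 'M[F]_n) : Prop := exists d, torus_of_dim d T.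

Definition maximal_torus n (G T : set 'M[F]_n) : Prop :=
  [/\ torus T, T `<=` G
    & forall T', torus T' -> T' `<=` G -> T `<=` T' -> T' = T].

End MatrixGroups.

Section RealGroups.
Variable R : realType.

(** A real algebraic group is given by its group of real points. Its
    complexification is the set of complex zeros of the real polynomials that
    vanish on it. *)
Definition complexification n (G : set 'M[R]_n) : set 'M[R[i]]_n :=
  [set A | forall p : mpoly.mpoly (n * n) R,
     (forall B, G B -> peval p B = 0) ->
     peval (mpoly.map_mpoly (real_complex R) p) A = 0].

Definition semisimple n (G : set 'M[R]_n) : Prop :=
  algebraic_group G /\ is_radical (complexification G) [set 1%:M].

Definition reductive n (G : set 'M[R]_n) : Prop :=
  algebraic_group G /\ is_unipotent_radical (complexification G) [set 1%:M].

(** The dimension of a maximal torus of the complexification. Maximal tori are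
    conjugate, so the maximum only serves to pick their common dimension, which
    is at most [n] for subgroups of [SL_n]. *)
Definition rank n (G : set 'M[R]_n) : nat :=
  \max_(d < n.+1 | `[< exists T, maximal_torus (complexification G) T /\
                                 torus_of_dim d T >]) d.

End RealGroups.

(* Main.v *)
(** Let [d = rank K] and work over the complex numbers. Multiplicative relations
    between eigenvalues separate [K] from the [H i].

    If an algebraic group [H] has rank less than [d], then no element of its
    complexification has [d] multiplicatively independent eigenvalues: the
    Zariski closure of the powers of such an element [h] contains all matrices
    obtained from the semisimple part of [h] by applying a character of the
    group generated by the eigenvalues, and these form a torus of dimension at
    least [d]. Since the complex field is uncountable, a countable form of the
    Nullstellensatz turns this into a uniform statement: finitely many nontrivial
    monomial relations are such that every [d] eigenvalues of every element of
    [H] satisfy one of them. This is a polynomial condition on the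
    characteristic polynomial, hence it is invariant under conjugation.

    If every [rho0 gamma] were conjugate into some [H i], the product of these
    conditions would hold on [rho0 Gamma], hence on its closure [K], on the
    complexification of [K], and on a torus of dimension [d] in it. A torus of
    dimension [d] has [d] independent weights, so at a point with
    multiplicatively independent coordinates it has [d] multiplicatively
    independent eigenvalues, a contradiction. No conjugacy theorem for tori is
    needed. *)

Require Import Defs.
From mathcomp Require Import all_boot all_order all_algebra.
From mathcomp Require Import boolp classical_sets cardinality reals complex.
From mathcomp Require Import perm mpoly ring lra.

Set Implicit Arguments.
Unset Strict Implicit.
Unset Printing Implicit Defensive.

Import Order.TTheory GRing.Theory Num.Theory.
Local Open Scope classical_set_scope.
Local Open Scope ring_scope.

(** * A Nullstellensatz for countably many inequations *)

Lemma mpoly_ring_ind (R : comNzRingType) N (P : {mpoly R[N]} -> Prop) :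
  (forall c, P c%:MP) -> (forall i, P 'X_i) ->
  (forall p q, P p -> P q -> P (p + q)) ->
  (forall p q, P p -> P q -> P (p * q)) -> forall p, P p.
Proof.
move=> PC PX PD PM p; have P1 : P 1 by rewrite -mpolyC1.
elim/mpolyind: p => [|c m p _ _ Pp]; first by rewrite -mpolyC0.
rewrite -mul_mpolyC mpolyXE_id; apply/(PD) => //; apply/PM => //.
apply: (big_ind P) => // i _.
by elim: (m i) => [|k IHk]; rewrite ?expr0 ?exprS //; apply/PM.
Qed.

Section CountableNullstellensatz.
Variables (F : closedFieldType) (N : nat).
Hypothesis F_uncountable : ~~ countable [set: F].
Implicit Types (M : set {mpoly F[N]}) (p q : {mpoly F[N]}).

Definition mideal M : Prop :=
  [/\ M 0, forall p q, M p -> M q -> M (p + q) & forall p q, M q -> M (p * q)].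

(** An uncountable field is not a countable union of finite fibres, so some fibre is infinite and
    one value [t] serves all [k]. *)
Lemma infinite_fibre (T : countType) (f : F -> T) :
  exists t, forall k, exists a : k.-tuple F, uniq a /\ forall i, f (tnth a i) = t.
Proof.
have [t inft] : exists t, infinite_set (f @^-1` [set t]).
  apply: contrapT => /forallNP fin; move/negP: F_uncountable; apply.
  have -> : [set: F] = \bigcup_(t in [set: T]) f @^-1` [set t].
    by apply/seteqP; split => // x _; exists (f x).
  apply: bigcup_countable => // t _; apply: finite_set_countable.
  by apply: contrapT; exact: fin.
exists t => k; have [X' Xsub kX] := infinite_set_fset k inft.
pose X := finmap.enum_fset X'.
have sz : size (take k X) == k by rewrite size_take_min; apply/eqP/minn_idPl.
exists (Tuple sz); split => [|i]; first exact/take_uniq/finmap.fset_uniq.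
by apply: Xsub; apply: mem_take (mem_tnth i (Tuple sz)).
Qed.

(** Polynomials with [msize] at most [D] are spanned by the finitely many monomials of degree less
    than [D]. One polynomial more than that forces a dependence, read off the left kernel of the
    coefficient matrix. *)
Lemma bounded_dependence D : exists k, forall g : 'I_k -> {mpoly F[N]},
  (forall i, (msize (g i) <= D)%N) ->
  exists2 c : 'I_k -> F, (exists i, c i != 0) & \sum_i c i *: g i = 0.
Proof.
pose K := #|{: 'X_{1..N < D}}|; exists K.+1 => g gD.
pose A : 'M[F]_(K.+1, K) := \matrix_(i, j) (g i)@_(enum_val j : 'X_{1..N < D}).
have : kermx A != 0.
  rewrite -mxrank_eq0 mxrank_ker subn_eq0 -ltnNge.
  by apply: leq_ltn_trans (rank_leq_col A) _.
case/rowV0Pn => v /sub_kermxP vA v0.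
exists (fun i => v 0 i); first by move: v0; case/rV0Pn => i ?; exists i.
apply/mpolyP => m; rewrite mcoeff0 raddf_sum /=.
under eq_bigr => i _ do rewrite mcoeffZ.
have [mD|mD] := ltnP (mdeg m) D; last first.
  rewrite big1 // => i _; rewrite memN_msupp_eq0 ?mulr0 //.
  by apply/negP => /msize_mdeg_lt; rewrite ltnNge (leq_trans (gD i) mD).
have := congr1 (fun B : 'rV_K => B 0 (enum_rank (BMultinom mD))) vA.
rewrite !mxE => {2}<-; apply: eq_bigr => i _.
by rewrite mxE enum_rankK.
Qed.

Variables (I : set {mpoly F[N]}) (J : countType) (s : J -> {mpoly F[N]}).
Hypothesis I_ideal : mideal I.
Hypothesis s1 : exists j, s j = 1.
Hypothesis sM : forall i j, exists k, s k = s i * s j.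
Hypothesis I_s : forall j, ~ I (s j).

Let avoids M := [/\ I `<=` M, mideal M & forall j, ~ M (s j)].

(** Zorn's lemma. If [p] lies outside a maximal [M], the larger ideal [M + (p)] must contain some
    [s j], so [s j] is a multiple of [p] modulo [M]. *)
Lemma maximal_avoiding : exists2 M, avoids M &
  forall p, ~ M p -> exists j q, M (s j - q * p).
Proof.
have [Fs FsP Ftot|M [PM maxM]] := @Zorn_bigcup _ (fun M => M = set0 \/ avoids M).
  have [[X [F0X avX]]|noX] := pselect (exists X, Fs X /\ avoids X); last first.
    left; apply/seteqP; split=> // p [X F0X Xp].
    case: (FsP _ F0X) => [X0|avX]; first by move: Xp; rewrite X0.
    by case: noX; exists X.
  right; split.
  - by move=> p Ip; exists X => //; case: avX => IX _ _; apply: IX.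
  - split.
    + by exists X => //; case: avX => _ [].
    + move=> p q [Y FY Yp] [Z FZ Zq].
      have [YZ|ZY] := Ftot _ _ FY FZ.
        exists Z => //; case: (FsP _ FZ) => [Z0|[_ [_ ZD _] _]].
          by move: Zq; rewrite Z0.
        by apply: ZD => //; apply: YZ.
      exists Y => //; case: (FsP _ FY) => [Y0|[_ [_ YD _] _]].
        by move: Yp; rewrite Y0.
      by apply: YD => //; apply: ZY.
    + move=> p q [Y FY Yq]; exists Y => //.
      case: (FsP _ FY) => [Y0|[_ [_ _ YM] _]]; last exact: YM.
      by move: Yq; rewrite Y0.
  - move=> j [Y FY Yj]; case: (FsP _ FY) => [Y0|[_ _ /(_ j)]//].
    by move: Yj; rewrite Y0.
have avI : avoids I by split.
have {PM} avM : avoids M.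
  case: PM => // M0; case: (maxM I); last by right.
  by rewrite M0; split=> // /(_ 0); apply; case: I_ideal.
exists M => // p Mp; apply: contrapT => noj.
case: avM => IM [M0 MD MM] Ms.
pose M' := [set x | exists q, M (x - q * p)].
case: (maxM M'); last first.
  right; split.
  - by move=> x /IM Mx; exists 0; rewrite mul0r subr0.
  - split.
    + by exists 0; rewrite mul0r subr0.
    + move=> x y [q Mx] [q' My]; exists (q + q').
      have -> : x + y - (q + q') * p = (x - q * p) + (y - q' * p) by ring.
      exact: MD.
    + move=> x y [q My]; exists (x * q).
      have -> : x * y - x * q * p = x * (y - q * p) by ring.
      exact: MM.
  - by move=> j [q Mj]; apply: noj; exists j, q.
split; first by move=> x Mx; exists 0; rewrite mul0r subr0.
by move=> /(_ p); case/(_ _)/Mp; exists 1; rewrite mul1r subrr.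
Qed.

(* Modulo an ideal [M] maximal among those avoiding the [s j], every variable is
   a constant: otherwise each [s (j a)] is a multiple of ['X_i - a] for all [a],
   uncountably many [a] share the same [s j] and a bound on the degree of the
   cofactor, and a linear dependence between cofactors puts [s j * h('X_i)] in
   [M] for some nonzero univariate [h], which splits into linear factors. *)
Lemma countable_nullstellensatz : exists a : 'I_N -> F,
  (forall p, I p -> p.@[a] = 0) /\ forall j, (s j).@[a] != 0.
Proof.
have [M [IM [M0 MD MM] Ms] maxM] := maximal_avoiding.
have MN p : M p -> M (- p) by rewrite -mulN1r; apply/MM.
(* A linear factor outside [M] divides some [s j'] modulo [M] and can be traded for it. Since the
   [s j] are closed under products, removing all factors would leave some [s k] in [M]. *)
have no_split i (r : seq F) j : (forall b, b \in r -> ~ M ('X_i - b%:MP)) ->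
    ~ M (s j * \prod_(b <- r) ('X_i - b%:MP)).
  elim: r j => [|b r IHr] j rM; first by rewrite big_nil mulr1; apply/Ms.
  rewrite big_cons => Mjb.
  have [j' [q Mj']] := maxM _ (rM b (mem_head _ _)).
  have [k sk] := sM j j'.
  apply: (IHr k) => [c cr|]; first by apply: rM; rewrite inE cr orbT.
  rewrite sk; set P := \prod_(_ <- r) _ in Mjb *.
  have -> : s j * s j' * P = s j * P * (s j' - q * ('X_i - b%:MP))
     + q * (s j * (('X_i - b%:MP) * P)) by ring.
  by apply/MD; apply/MM.
have rational i : exists a, M ('X_i - a%:MP).
  apply: contrapT => /forallNP noa.
  have /choice [jg jgP] : forall a, exists jg : J * {mpoly F[N]},
      M (s jg.1 - jg.2 * ('X_i - a%:MP)).
    by move=> a; have [j [g Mj]] := maxM _ (noa a); exists (j, g).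
  have [[j D] fib] := infinite_fibre (fun a => ((jg a).1, msize (jg a).2)).
  have [k dep] := bounded_dependence D.
  have [a [ua fa]] := fib k.
  pose g l := (jg (tnth a l)).2.
  have [|c [l0 cl0] cg] := dep g.
    by move=> l; move: (fa l) => [_ <-].
  (* In the term [l] of [s j] times [h], replacing [s j] by [g l] times the missing linear factor
     completes the product, and the vanishing sum of the [c l *: g l] factors out. The value of [h]
     at the point [l0] is [c l0] times nonzero differences, so [h] is nonzero. *)
  pose h : {poly F} := \sum_l c l *: \prod_(l' | l' != l) ('X - (tnth a l')%:P).
  have h0 : h != 0.
    apply/eqP => /(congr1 (fun u : {poly F} => u.[tnth a l0])).
    rewrite horner_sum (bigD1 l0) //= hornerZ horner_prod [X in _ + X]big1 => [|l ll0].
      rewrite addr0 horner0 => /eqP; rewrite mulf_eq0 (negPf cl0) /=.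
      apply/negP/prodf_neq0 => l ll0; rewrite hornerXsubC subr_eq0.
      apply: contra ll0 => /eqP al; apply/eqP/esym.
      by move/tuple_uniqP: ua; apply.
    rewrite hornerZ horner_prod (bigD1 l0) 1?eq_sym //= hornerXsubC subrr.
    by rewrite mul0r mulr0.
  have hM : M (s j * (map_poly (@mpolyC N F) h).['X_i]).
    have -> : (map_poly (@mpolyC N F) h).['X_i] =
        \sum_l c l *: \prod_(l' | l' != l) ('X_i - (tnth a l')%:MP).
      rewrite rmorph_sum horner_sum; apply: eq_bigr => l _ /=.
      rewrite map_polyZ hornerZ mul_mpolyC; congr (_ *: _).
      rewrite rmorph_prod horner_prod; apply: eq_bigr => l' _ /=.
      by rewrite map_polyXsubC hornerXsubC.
    set P := fun l : 'I_k => \prod_(l' | l' != l) ('X_i - (tnth a l')%:MP).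
    have -> : s j * \sum_l c l *: P l =
        \sum_l c l *: (P l * (s j - g l * ('X_i - (tnth a l)%:MP))).
      apply/eqP; rewrite -subr_eq0 mulr_sumr -sumrB.
      rewrite (eq_bigr (fun l => c l *: g l *
          \prod_l' ('X_i - (tnth a l')%:MP))) => [|l _].
        by rewrite -mulr_suml cg mul0r.
      rewrite [in RHS](bigD1 l) //= -/(P l) -scalerAr -scalerBr -scalerAl.
      by congr (_ *: _); ring.
    elim/big_rec: _ => // l x _ Mx; apply/MD => //.
    rewrite -mul_mpolyC; apply/MM/MM.
    by move: (jgP (tnth a l)); have [-> _] := fa l.
  have [r hr] := closed_field_poly_normal h.
  have lc : lead_coef h != 0 by rewrite lead_coef_eq0.
  apply: (no_split i r j) => [b _|]; first exact: noa.
  have -> : \prod_(b <- r) ('X_i - b%:MP) =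
      (lead_coef h)^-1%:MP * (map_poly (@mpolyC N F) h).['X_i].
    rewrite hr map_polyZ hornerZ lead_coefZ lead_coef_prod_XsubC mulr1.
    rewrite mulrA -mpolyCM mulVf // mul1r rmorph_prod horner_prod.
    by apply: eq_bigr => b _ /=; rewrite map_polyXsubC hornerXsubC.
  by rewrite mulrCA; apply/MM.
have /choice [a aP] := rational.
(* Every variable is congruent to a constant, so evaluation at [a] is reduction modulo [M]. *)
have ev p : M (p - (p.@[a])%:MP).
  elim/mpoly_ring_ind: p => [c|i|p q Mp Mq|p q Mp Mq].
  - by rewrite mevalC subrr.
  - by rewrite mevalXU.
  - by rewrite mevalD mpolyCD opprD addrACA; apply/MD.
  - rewrite mevalM mpolyCM.
    set p' := _%:MP in Mp *; set q' := _%:MP in Mq *.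
    have -> : p * q - p' * q' = q * (p - p') + p' * (q - q') by ring.
    by apply/MD; apply/MM.
exists a; split=> [p /IM Mp|j].
  apply/eqP; case: (altP eqP) => // pa0; case: s1 => j sj; case: (Ms j).
  have -> : s j = (p.@[a])^-1%:MP * (p - (p - (p.@[a])%:MP)).
    by rewrite opprB addrC subrK -mpolyCM mulVf.
  by apply/MM/MD => //; apply/MN.
apply/eqP => sj0; apply: (Ms j).
by have := ev (s j); rewrite sj0 mpolyC0 subr0.
Qed.
End CountableNullstellensatz.

(** Nested intervals. Stage [n] keeps a closed outer third of the current interval that misses the
    [n]-th number of a supposed enumeration. The supremum of the left ends lies in all intervals, so
    it escapes the enumeration. *)
Lemma real_uncountable (R : realType) : ~~ countable [set: R].
Proof.
apply/negP => /countable_injP [f finj].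
have /choice [e eP] : forall n, exists x, forall y, f y = n -> y = x.
  move=> n; have [[x fx]|nox] := pselect (exists x, f x = n).
    by exists x => y fy; apply: finj; rewrite ?in_setE // fx.
  by exists 0 => y fy; case: nox; exists y.
pose step n (u : R * R) : R * R :=
  let m := (u.1 *+ 2 + u.2) / 3 in
  if e n <= m then ((u.1 + u.2 *+ 2) / 3, u.2) else (u.1, m).
pose u := fix u n := if n is k.+1 then step k (u k) else (0, 1).
have ult n : (u n).1 < (u n).2.
  by elim: n => [|n IHn] /=; [lra | rewrite /step; case: ifP => _ /=; lra].
have ustep n : (u n).1 <= (u n.+1).1 /\ (u n.+1).2 <= (u n).2.
  by have := ult n; rewrite /= /step; case: ifP => _ /=; split; lra.
have umono n k : (u n).1 <= (u (n + k)%N).1 /\ (u (n + k)%N).2 <= (u n).2.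
  elim: k => [|k [IH1 IH2]]; first by rewrite addn0.
  by rewrite addnS; have [h1 h2] := ustep (n + k)%N; split; lra.
have ub n k : (u n).1 <= (u k).2.
  have := umono n k; have := umono k n; have := ult (n + k)%N.
  by rewrite [(k + n)%N]addnC => h1 [h2 h3] [h4 h5]; lra.
pose y := sup (range (fun n => (u n).1)).
have lb n : (u n).1 <= y.
  apply: ub_le_sup; last by exists n.
  by exists (u 0%N).2 => _ [k _ <-]; apply: ub.
have yb n : y <= (u n).2.
  by apply: ge_sup; [exists (u 0%N).1; exists 0%N | move=> _ [k _ <-]; apply: ub].
have := eP (f y) y erefl; set n := f y => yn.
have := lb n.+1; have := yb n.+1; have := ult n.
rewrite /= /step -yn; case: ifP => /= h; first by lra.
by move: h => /negbT; rewrite -ltNge; lra.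
Qed.

Lemma complex_uncountable (R : realType) : ~~ countable [set: R[i]].
Proof.
apply/negP => /countable_injP [f finj]; move/negP: (real_uncountable R); apply.
apply/countable_injP; exists (f \o @real_complex R) => x y _ _ /= fxy.
by apply: (@complexI R); apply: finj; rewrite ?in_setE.
Qed.

(** * Polynomial functions and Zariski closure *)

Section PolynomialFunctions.
Variables (F : fieldType) (X : Type) (N : nat) (c : X -> 'I_N -> F).
Implicit Types (f g : X -> F).

(** The coordinates [c] are a parameter, so that the same closure properties serve functions of a
    matrix and functions of a matrix together with a list of its eigenvalues. *)
Definition pfun f : Prop := exists p : {mpoly F[N]}, forall x, f x = p.@[c x].

Lemma eq_pfun f g : f =1 g -> pfun g -> pfun f.
Proof. by move=> fg [p gp]; exists p => x; rewrite fg. Qed.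

Lemma pfun_cst a : pfun (fun=> a).
Proof. by exists a%:MP => x; rewrite mevalC. Qed.

Lemma pfun_coord k : pfun (fun x => c x k).
Proof. by exists 'X_k => x; rewrite mevalXU. Qed.

Lemma pfunD f g : pfun f -> pfun g -> pfun (fun x => f x + g x).
Proof. by move=> [p fp] [q gq]; exists (p + q) => x; rewrite mevalD fp gq. Qed.

Lemma pfunM f g : pfun f -> pfun g -> pfun (fun x => f x * g x).
Proof. by move=> [p fp] [q gq]; exists (p * q) => x; rewrite mevalM fp gq. Qed.

Lemma pfunN f : pfun f -> pfun (fun x => - f x).
Proof. by move=> [p fp]; exists (- p) => x; rewrite mevalN fp. Qed.

Lemma pfunB f g : pfun f -> pfun g -> pfun (fun x => f x - g x).
Proof. by move=> hf hg; apply: pfunD => //; apply: pfunN. Qed.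

Lemma pfun_sum (T : Type) (r : seq T) (P : pred T) (f : T -> X -> F) :
  (forall i, P i -> pfun (f i)) -> pfun (fun x => \sum_(i <- r | P i) f i x).
Proof.
move=> hf; elim: r => [|i r IHr].
  by apply: eq_pfun (pfun_cst 0) => x; rewrite big_nil.
case Pi: (P i); last by apply: eq_pfun IHr => x; rewrite big_cons Pi.
by apply: eq_pfun (pfunD (hf i Pi) IHr) => x; rewrite big_cons Pi.
Qed.

Lemma pfun_prod (T : Type) (r : seq T) (P : pred T) (f : T -> X -> F) :
  (forall i, P i -> pfun (f i)) -> pfun (fun x => \prod_(i <- r | P i) f i x).
Proof.
move=> hf; elim: r => [|i r IHr].
  by apply: eq_pfun (pfun_cst 1) => x; rewrite big_nil.
case Pi: (P i); last by apply: eq_pfun IHr => x; rewrite big_cons Pi.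
by apply: eq_pfun (pfunM (hf i Pi) IHr) => x; rewrite big_cons Pi.
Qed.

Lemma pfunX f k : pfun f -> pfun (fun x => f x ^+ k).
Proof.
move=> hf; elim: k => [|k IHk]; first exact: pfun_cst.
by apply: eq_pfun (pfunM hf IHk) => x; rewrite exprS.
Qed.

Lemma pfun_meval k (p : {mpoly F[k]}) (f : 'I_k -> X -> F) :
  (forall i, pfun (f i)) -> pfun (fun x => p.@[fun i => f i x]).
Proof.
move=> hf; elim/mpoly_ring_ind: p => [a|i|p q hp hq|p q hp hq].
- by apply: eq_pfun (pfun_cst a) => x; rewrite mevalC.
- by apply: eq_pfun (hf i) => x; rewrite mevalXU.
- by apply: eq_pfun (pfunD hp hq) => x; rewrite mevalD.
- by apply: eq_pfun (pfunM hp hq) => x; rewrite mevalM.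
Qed.

Definition mxpfun m n (G : X -> 'M[F]_(m, n)) : Prop :=
  forall i j, pfun (fun x => G x i j).

Lemma mxpfun_cst m n (A : 'M[F]_(m, n)) : mxpfun (fun=> A).
Proof. by move=> i j; apply: pfun_cst. Qed.

Lemma mxpfunZ m n f (G : X -> 'M[F]_(m, n)) :
  pfun f -> mxpfun G -> mxpfun (fun x => f x *: G x).
Proof.
by move=> hf hG i j; apply: eq_pfun (pfunM hf (hG i j)) => x; rewrite mxE.
Qed.

Lemma mxpfun_sum m n (T : Type) (r : seq T) (P : pred T)
    (G : T -> X -> 'M[F]_(m, n)) :
  (forall i, P i -> mxpfun (G i)) ->
  mxpfun (fun x => \sum_(i <- r | P i) G i x).
Proof.
move=> hG i j; apply: (@eq_pfun _ (fun x => \sum_(k <- r | P k) G k x i j)).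
  by move=> x; rewrite summxE.
by apply: pfun_sum => k Pk; apply: hG.
Qed.

Lemma mxpfunM m n k (G : X -> 'M[F]_(m, n)) (H : X -> 'M[F]_(n, k)) :
  mxpfun G -> mxpfun H -> mxpfun (fun x => G x *m H x).
Proof.
move=> hG hH i j; apply: (@eq_pfun _ (fun x => \sum_l G x i l * H x l j)).
  by move=> x; rewrite mxE.
by apply: pfun_sum => l _; apply: pfunM.
Qed.

Lemma mxpfunX n (G : X -> 'M[F]_n) k :
  mxpfun G -> mxpfun (fun x => G x ^+ k).
Proof.
move=> hG; elim: k => [|k IHk]; first exact: mxpfun_cst.
by move=> i j; apply: eq_pfun (mxpfunM hG IHk i j) => x; rewrite exprS.
Qed.

Lemma pfun_det n (G : X -> 'M[F]_n) : mxpfun G -> pfun (fun x => \det (G x)).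
Proof.
move=> hG; apply: pfun_sum => s _; apply: pfunM; first exact: pfun_cst.
by apply: pfun_prod => i _; apply: hG.
Qed.

Lemma mxpfun_adj n (G : X -> 'M[F]_n) :
  mxpfun G -> mxpfun (fun x => \adj (G x)).
Proof.
move=> hG i j; apply: (@eq_pfun _ (fun x => cofactor (G x) j i)).
  by move=> x; rewrite mxE.
apply: pfunM; first exact: pfun_cst.
apply: pfun_det => k l; apply: eq_pfun (hG (lift j k) (lift i l)) => x.
by rewrite !mxE.
Qed.

Definition ppfun (P : X -> {poly F}) : Prop := forall k, pfun (fun x => (P x)`_k).

Lemma ppfun_sum (T : finType) (P : T -> X -> {poly F}) :
  (forall i, ppfun (P i)) -> ppfun (fun x => \sum_i P i x).
Proof.
move=> hP k; apply: (@eq_pfun _ (fun x => \sum_i (P i x)`_k)).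
  by move=> x; rewrite coef_sum.
by apply: pfun_sum => i _; apply: hP.
Qed.

Lemma ppfunM (P Q : X -> {poly F}) :
  ppfun P -> ppfun Q -> ppfun (fun x => P x * Q x).
Proof.
move=> hP hQ k.
apply: (@eq_pfun _ (fun x => \sum_(j < k.+1) (P x)`_j * (Q x)`_(k - j))).
  by move=> x; rewrite coefM.
by apply: pfun_sum => i _; apply: pfunM.
Qed.

Lemma ppfun_prod (T : Type) (r : seq T) (P : T -> X -> {poly F}) :
  (forall i, ppfun (P i)) -> ppfun (fun x => \prod_(i <- r) P i x).
Proof.
move=> hP; elim: r => [|i r IHr] k.
  by apply: eq_pfun (pfun_cst (1 : {poly F})`_k) => x; rewrite big_nil.
by apply: eq_pfun (ppfunM (hP i) IHr k) => x; rewrite big_cons.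
Qed.

Lemma ppfun_cst P : ppfun (fun=> P).
Proof. by move=> k; apply: pfun_cst. Qed.

Lemma ppfun_char_poly n (G : X -> 'M[F]_n) :
  mxpfun G -> ppfun (fun x => char_poly (G x)).
Proof.
move=> hG; apply: ppfun_sum => s; apply: ppfunM; first exact: ppfun_cst.
apply: ppfun_prod => i k.
apply: (@eq_pfun _ (fun x => ('X *+ (i == s i))`_k - (G x i (s i)) *+ (k == 0))).
  by move=> x; rewrite !mxE coefB coefC; case: (k == 0%N).
apply: pfunB; first exact: pfun_cst.
by case: (k == 0%N); [apply: hG | apply: pfun_cst].
Qed.

End PolynomialFunctions.

Lemma pfun_comp (F : fieldType) X Y N N' (c : X -> 'I_N -> F)
    (c' : Y -> 'I_N' -> F) (f : X -> F) (G : Y -> X) :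
  pfun c f -> (forall k, pfun c' (fun y => c (G y) k)) ->
  pfun c' (fun y => f (G y)).
Proof.
move=> [p fp] hG; apply: eq_pfun (pfun_meval p hG) => y.
by rewrite fp.
Qed.

Section MatrixPolynomials.
Variables (F : fieldType) (n : nat).
Implicit Types (A B : 'M[F]_n) (S : set 'M[F]_n).

Definition entries A (k : 'I_(n * n)) : F := mxvec A 0 k.

Lemma mxpfun_id : mxpfun entries id.
Proof.
move=> i j; apply: eq_pfun (pfun_coord entries (mxvec_index i j)) => A.
by rewrite /entries mxvecE.
Qed.

Lemma zariski_closureP S A : zariski_closure S A <->
  forall f, pfun entries f -> (forall B, S B -> f B = 0) -> f A = 0.
Proof.
split=> [clA f [p fp] fS|h p pS].
  by rewrite fp; apply: clA => B /fS; rewrite fp.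
by apply: (h (peval p)) => //; exists p.
Qed.

Lemma zariski_closed_zeros (T : Type) (f : T -> 'M[F]_n -> F) :
  (forall t, pfun entries (f t)) ->
  zariski_closed [set A | forall t, f t A = 0].
Proof.
move=> hf; apply/seteqP; split=> A; last by move=> fA p; apply.
by move/zariski_closureP => clA t; apply: clA => // B; apply.
Qed.

End MatrixPolynomials.

Lemma mxpfun_entries (F : fieldType) X N (c : X -> 'I_N -> F) n
    (G : X -> 'M[F]_n) (f : 'M[F]_n -> F) :
  pfun (@entries F n) f -> mxpfun c G -> pfun c (fun x => f (G x)).
Proof.
move=> hf hG; apply: pfun_comp hf _ => k.
case/mxvec_indexP: k => i j; apply: eq_pfun (hG i j) => x.
by rewrite /entries mxvecE.
Qed.

Lemma polynomial_mapP (F : fieldType) m n (f : 'M[F]_m -> 'M[F]_n) :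
  polynomial_map f <-> mxpfun (@entries F m) f.
Proof.
split=> [[P fP] i j|hf]; first by exists (P i j) => A; rewrite fP.
have /choice [P PE] : forall ij : 'I_n * 'I_n, exists p : {mpoly F[m * m]},
    forall A, f A ij.1 ij.2 = p.@[entries A] by case=> i j; apply: hf.
by exists (fun i j => P (i, j)) => A i j; rewrite (PE (i, j)).
Qed.

(** * Complexification as a Zariski closure *)

Lemma meval_map_mpoly (R S : comNzRingType) (f : {rmorphism R -> S}) N
    (p : {mpoly R[N]}) (v : 'I_N -> R) :
  (map_mpoly f p).@[f \o v] = f p.@[v].
Proof.
elim/mpoly_ring_ind: p => [a|i|p q IHp IHq|p q IHp IHq].
- by rewrite map_mpolyC !mevalC.
- by rewrite map_mpolyX !mevalXU.
- by rewrite (rmorphD (map_mpoly f)) !mevalD IHp IHq rmorphD.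
- by rewrite (rmorphM (map_mpoly f)) !mevalM IHp IHq rmorphM.
Qed.

(** The splitting into real and imaginary parts. It exists for constants and variables, and passes
    to products because [i * i = -1]. *)
Lemma mpoly_basis_decomp (R S : comNzRingType) (f : {rmorphism R -> S}) (i : S) :
  i * i = -1 -> (forall a, exists x y, a = f x + i * f y) ->
  forall N (p : {mpoly S[N]}), exists p1 p2,
    p = map_mpoly f p1 + i%:MP * map_mpoly f p2.
Proof.
move=> ii fi N p.
elim/mpoly_ring_ind: p => [a|j|p q [p1 [p2 ->]] [q1 [q2 ->]]|
    p q [p1 [p2 ->]] [q1 [q2 ->]]].
- have [x [y ->]] := fi a.
  by exists x%:MP, y%:MP; rewrite !map_mpolyC -mpolyCM -mpolyCD.
- by exists 'X_j, 0; rewrite map_mpolyX (rmorph0 (map_mpoly f)) mulr0 addr0.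
- by exists (p1 + q1), (p2 + q2); rewrite !(rmorphD (map_mpoly f)); ring.
- exists (p1 * q1 - p2 * q2), (p1 * q2 + p2 * q1).
  rewrite (rmorphB (map_mpoly f)) (rmorphD (map_mpoly f)).
  rewrite !(rmorphM (map_mpoly f)).
  have {}ii : i%:MP * i%:MP = -1 :> {mpoly S[N]}.
    by rewrite -mpolyCM ii mpolyCN mpolyC1.
  set x1 := map_mpoly _ p1; set x2 := map_mpoly _ p2.
  set y1 := map_mpoly _ q1; set y2 := map_mpoly _ q2; set u := _%:MP in ii *.
  have -> : x1 * y1 - x2 * y2 = x1 * y1 + (u * u) * x2 * y2.
    by rewrite ii mulN1r mulNr.
  by ring.
Qed.

(** At points coming from [F] the two parts of a polynomial over [L] take values in [F], so they
    vanish wherever it does. Hence equations with coefficients in [F] already cut out the closure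
    over [L]. *)
Lemma base_change_closure (F L : fieldType) (f : {rmorphism F -> L}) (i : L) :
  i * i = -1 -> (forall a, exists x y, a = f x + i * f y) ->
  (forall x y, f x + i * f y = 0 -> x = 0 /\ y = 0) ->
  forall n (G : set 'M[F]_n) (A : 'M[L]_n),
  (forall p : {mpoly F[n * n]}, (forall B, G B -> peval p B = 0) ->
     peval (map_mpoly f p) A = 0) <->
  zariski_closure (map_mx f @` G) A.
Proof.
move=> ii fi fi0 n G A.
have pevalE (q : {mpoly F[n * n]}) (B : 'M[F]_n) :
    peval (map_mpoly f q) (map_mx f B) = f (peval q B).
  rewrite -(meval_map_mpoly f); apply: meval_eq => k /=.
  by rewrite -map_mxvec mxE.
split=> clA p pG; last first.
  by apply: clA => _ [B GB <-]; rewrite pevalE pG // rmorph0.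
have [p1 [p2 pE]] := mpoly_basis_decomp ii fi p.
have {}pE B : peval p B =
    peval (map_mpoly f p1) B + i * peval (map_mpoly f p2) B.
  by rewrite pE /peval mevalD mevalM mevalC.
have pB B : G B -> peval p1 B = 0 /\ peval p2 B = 0.
  by move=> GB; apply: fi0; rewrite -!pevalE -pE; apply: pG; exists B.
by rewrite pE !clA ?mulr0 ?addr0 // => B /pB[].
Qed.

Lemma complexificationE (R : realType) n (G : set 'M[R]_n) :
  complexification G = zariski_closure (map_mx (real_complex R) @` G).
Proof.
have ii : 'i%C * 'i%C = -1 :> R[i] by rewrite -expr2 sqr_i.
have dec (a : R[i]) : exists x y, a = real_complex R x + 'i%C * real_complex R y.
  by exists (complex.Re a), (complex.Im a); apply: complexE.
have dec0 (x y : R) : real_complex R x + 'i%C * real_complex R y = 0 ->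
    x = 0 /\ y = 0.
  by rewrite -[LHS](complexE (x +i* y)%C) => -[].
apply/seteqP; split=> A.
  exact: (iffLR (@base_change_closure _ _ (real_complex R) _ ii dec dec0 n G A)).
exact: (iffRL (@base_change_closure _ _ (real_complex R) _ ii dec dec0 n G A)).
Qed.

(** By the fundamental theorem [u] is a polynomial in the elementary symmetric functions, and these
    are, up to sign, coefficients of the characteristic polynomial. The index [i] stands for the
    function of degree [i + 1]. *)
Lemma symmetric_char_poly (F : fieldType) n (u : {mpoly F[n]}) :
  u \is symmetric -> exists2 U : 'M[F]_n -> F, pfun (@entries F n) U &
    forall A (l : n.-tuple F), char_poly A = \prod_(x <- l) ('X - x%:P) ->
      U A = u.@[tnth l].
Proof.
move=> /sym_fundamental [t [tE _]].
exists (fun A => t.@[fun i : 'I_n => (-1) ^+ i.+1 * (char_poly A)`_(n - i.+1)]).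
  apply: pfun_meval => i; apply: pfunM; first exact: pfun_cst.
  exact/ppfun_char_poly/mxpfun_id.
move=> A l Al; rewrite -tE comp_mpoly_meval; apply: meval_eq => i /=.
have i1 : (i.+1 < n.+1)%N by rewrite ltnS.
rewrite tnth_mktuple Al (mroots_coeff l (Ordinal i1)) /=.
by rewrite mulrA -expr2 sqrr_sign mul1r.
Qed.

Lemma char_poly_roots (F : closedFieldType) n (A : 'M[F]_n) :
  exists l : n.-tuple F, char_poly A = \prod_(x <- l) ('X - x%:P).
Proof.
have [r rE] := closed_field_poly_normal (char_poly A).
rewrite (monicP (char_poly_monic A)) scale1r in rE.
have sz : size r == n.
  by have := size_char_poly A; rewrite rE size_prod_XsubC => -[->].
by exists (Tuple sz).
Qed.

(** * Exponential polynomials and spectral projections *)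

Section GeneralizedGeometric.
Variable F : fieldType.
Implicit Types (a b : nat -> F) (p q : {poly F}).

Definition shift_sub (nu : F) a : nat -> F := fun k => a k.+1 - nu * a k.

(* Sequences of the form [k |-> nu ^ k * q k] with [q] a polynomial, in a form
   that needs no assumption on the characteristic. *)
Definition geometric nu a : Prop := exists e, iter e (shift_sub nu) a = fun=> 0.

(** The value at 0 of the sequence obtained by applying to [a] the polynomial [p] in the shift
    operator. *)
Definition pairing a p : F := \sum_(j < size p) p`_j * a j.

Lemma pairing_widen a p k : (size p <= k)%N ->
  pairing a p = \sum_(j < k) p`_j * a j.
Proof.
move=> pk; rewrite /pairing (big_ord_widen _ (fun j => p`_j * a j) pk) big_mkcond /=.
apply: eq_bigr => j _; case: ltnP => // pj.
by rewrite nth_default ?mul0r.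
Qed.

Lemma pairingD a p q : pairing a (p + q) = pairing a p + pairing a q.
Proof.
have [hp hq] := (leq_maxl (size p) (size q), leq_maxr (size p) (size q)).
rewrite (pairing_widen a hp) (pairing_widen a hq) -big_split /=.
rewrite (pairing_widen a (size_polyD p q)).
by apply: eq_bigr => j _; rewrite coefD mulrDl.
Qed.

Lemma pairingZ a c p : pairing a (c *: p) = c * pairing a p.
Proof.
rewrite (pairing_widen a (size_scale_leq c p)) mulr_sumr.
by apply: eq_bigr => j _; rewrite coefZ mulrA.
Qed.

Lemma pairing_sum (I : Type) (r : seq I) (a : I -> nat -> F) p :
  pairing (fun k => \sum_(v <- r) a v k) p = \sum_(v <- r) pairing (a v) p.
Proof.
rewrite exchange_big /=; apply: eq_bigr => j _.
by rewrite mulr_sumr.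
Qed.

Lemma pairing0 p : pairing (fun=> 0) p = 0.
Proof. by rewrite /pairing big1 // => j _; rewrite mulr0. Qed.

Lemma pairing1 a : pairing a 1 = a 0%N.
Proof. by rewrite /pairing size_poly1 big_ord1 coef1 mul1r. Qed.

Lemma pairing_XsubC a nu p :
  pairing a (p * ('X - nu%:P)) = pairing (shift_sub nu a) p.
Proof.
have -> : p * ('X - nu%:P) = 'X * p + (- nu) *: p.
  by rewrite mulrBr mulrC [p * _%:P]mulrC mul_polyC scaleNr.
rewrite pairingD pairingZ.
have sz : (size ('X * p)%R <= (size p).+1)%N.
  by rewrite mulrC (leq_trans (size_polyMleq _ _)) // size_polyX addn2.
rewrite (pairing_widen a sz) big_ord_recl coefXM mul0r add0r.
rewrite /pairing mulr_sumr -big_split; apply: eq_bigr => j _.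
by rewrite coefXM /= /bump /= add1n /shift_sub; ring.
Qed.

Lemma pairing_XsubC_exp a nu e p :
  pairing a (p * ('X - nu%:P) ^+ e) = pairing (iter e (shift_sub nu) a) p.
Proof.
elim: e a p => [|e IHe] a p; first by rewrite expr0 mulr1.
by rewrite exprSr mulrA pairing_XsubC IHe -iterSr.
Qed.

(** The polynomial [P] kills all sequences but [a v] and is coprime to a power of ['X - (nu v)%:P]
    that kills [a v]. A Bezout identity thus writes [a v 0] as the pairing of [a v] with a multiple
    of [P], which is also the pairing of the zero sum with it. *)
Lemma geometric_indep (I : eqType) (r : seq I) (nu : I -> F)
    (a : I -> nat -> F) : uniq r -> {in r &, injective nu} ->
  (forall v, v \in r -> geometric (nu v) (a v)) ->
  (forall k, \sum_(v <- r) a v k = 0) -> forall v, v \in r -> a v 0%N = 0.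
Proof.
move=> ur inj_nu geo_a sum0 v vr.
have /choice [e eP] : forall w, exists k, w \in r ->
    iter k (shift_sub (nu w)) (a w) = fun=> 0.
  move=> w; have [wr|_] := boolP (w \in r); last by exists 0%N.
  by have [k ak] := geo_a w wr; exists k.
pose P := \prod_(w <- r | w != v) ('X - (nu w)%:P) ^+ e w.
have cop : coprimep P (('X - (nu v)%:P) ^+ e v).
  apply: coprimep_expr; rewrite /P big_seq_cond.
  elim/big_rec: _ => [|w Q /andP [wr wv] Qv]; first exact: coprime1p.
  rewrite coprimepMl Qv andbT coprimep_expl // coprimep_XsubC2 // subr_eq0.
  by apply: contra wv => /eqP nuvw; apply/eqP/inj_nu.
have /Bezout_eq1_coprimepP [[x y] /= xy1] := cop.
rewrite -pairing1 -xy1 pairingD pairing_XsubC_exp eP // pairing0 addr0.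
have : pairing (fun k => \sum_(w <- r) a w k) (x * P) = 0.
  have -> : (fun k => \sum_(w <- r) a w k) = fun=> 0 by apply/funext.
  by rewrite pairing0.
rewrite pairing_sum (big_rem v) //= big_seq big1 ?addr0 // => w.
rewrite rem_filter // mem_filter /= => /andP [wv wr].
by rewrite /P (big_rem w) //= wv mulrCA mulrC pairing_XsubC_exp eP // pairing0.
Qed.

Lemma iter_shift_sub0 nu e : iter e (shift_sub nu) (fun=> 0) = fun=> 0.
Proof.
elim: e => //= e ->; apply/funext => k.
by rewrite /shift_sub mulr0 subrr.
Qed.

Lemma iter_shift_subD nu e a b :
  iter e (shift_sub nu) (fun k => a k + b k) =
  fun k => iter e (shift_sub nu) a k + iter e (shift_sub nu) b k.
Proof.
elim: e => //= e ->; apply/funext => k.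
by rewrite /shift_sub; ring.
Qed.

Lemma iter_shift_subZ nu e c a :
  iter e (shift_sub nu) (fun k => c * a k) =
  fun k => c * iter e (shift_sub nu) a k.
Proof.
elim: e => //= e ->; apply/funext => k.
by rewrite /shift_sub; ring.
Qed.

Lemma iter_shift_sub_le nu e e' a : (e <= e')%N ->
  iter e (shift_sub nu) a = (fun=> 0) -> iter e' (shift_sub nu) a = fun=> 0.
Proof. by move=> ee' a0; rewrite -(subnK ee') iterD a0 iter_shift_sub0. Qed.

Lemma geometric0 nu : geometric nu (fun=> 0).
Proof. by exists 0%N. Qed.

Lemma geometricD nu a b :
  geometric nu a -> geometric nu b -> geometric nu (fun k => a k + b k).
Proof.
move=> [e ae] [f bf]; exists (maxn e f); rewrite iter_shift_subD.
rewrite (iter_shift_sub_le (leq_maxl e f) ae).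
rewrite (iter_shift_sub_le (leq_maxr e f) bf).
by apply/funext => k; rewrite addr0.
Qed.

(** A Leibniz rule: shifting the product gives two products, in each of which one factor needs one
    shift less to reach 0. Hence the induction on [e + f]. *)
Lemma iter_shift_subM nu mu e f a b :
  iter e (shift_sub nu) a = (fun=> 0) -> iter f (shift_sub mu) b = (fun=> 0) ->
  iter (e + f) (shift_sub (nu * mu)) (fun k => a k * b k) = fun=> 0.
Proof.
have [N] := ubnP (e + f); elim: N => // N IHN in e f a b *; rewrite ltnS.
case: e => [|e] efN.
  move=> /= -> _; rewrite (_ : (fun k => 0 * b k) = fun=> 0) ?iter_shift_sub0 //.
  by apply/funext => k; rewrite mul0r.
case: f efN => [|f] efN.
  move=> _ b0; rewrite (b0 : b = _) (_ : (fun k => a k * 0) = fun=> 0) ?iter_shift_sub0 //.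
  by apply/funext => k; rewrite mulr0.
move=> ae bf; rewrite addSn iterSr.
have shiftb : iter f.+1 (shift_sub mu) (fun k => b k.+1) = fun=> 0.
  have itS g : iter g (shift_sub mu) (fun k => b k.+1) =
      fun k => iter g (shift_sub mu) b k.+1.
    by elim: g => //= g ->.
  by rewrite itS bf.
have -> : shift_sub (nu * mu) (fun k => a k * b k) =
    fun k => shift_sub nu a k * b k.+1 + nu * (a k * shift_sub mu b k).
  by apply/funext => k; rewrite /shift_sub; ring.
rewrite iter_shift_subD iter_shift_subZ.
have ae' : iter e (shift_sub nu) (shift_sub nu a) = fun=> 0 by rewrite -iterSr.
have bf' : iter f (shift_sub mu) (shift_sub mu b) = fun=> 0 by rewrite -iterSr.
have efN' : (e + f.+1 < N)%N by rewrite -addSn.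
have -> := IHN e f.+1 _ _ efN' ae' shiftb.
rewrite addnS -addSn; rewrite addnS -addSn in efN'.
have -> := IHN e.+1 f _ _ efN' ae bf'.
by apply/funext => k; rewrite mulr0 addr0.
Qed.

Lemma geometricM nu mu a b : geometric nu a -> geometric mu b ->
  geometric (nu * mu) (fun k => a k * b k).
Proof. by move=> [e ae] [f bf]; exists (e + f)%N; apply: iter_shift_subM. Qed.

Lemma geometric_sum (T : finType) (P : pred T) nu (b : T -> nat -> F) :
  (forall t, P t -> geometric nu (b t)) ->
  geometric nu (fun k => \sum_(t | P t) b t k).
Proof.
move=> hb; elim: (index_enum T) => [|t r IHr].
  rewrite (_ : (fun _ => _) = fun=> 0); first exact: geometric0.
  by apply/funext => k; rewrite big_nil.
rewrite (_ : (fun _ => _) = fun k => (if P t then b t k else 0)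
    + \sum_(t <- r | P t) b t k); last first.
  by apply/funext => k; rewrite big_cons; case: (P t); rewrite ?add0r.
by apply: geometricD => //; case Pt: (P t); [exact: hb|exact: geometric0].
Qed.

End GeneralizedGeometric.

Section Twist.
Variables (F : fieldType) (m : nat) (mu phi : 'I_m -> F).

(* [c] is obtained from the value at [0] of the exponential polynomial [a] by
   replacing every eigenvalue [mu i] by [phi i]. *)
Definition twist (a : nat -> F) (c : F) : Prop :=
  exists (T : finType) (M : T -> 'I_m -> nat) (b : T -> nat -> F),
  [/\ forall t, geometric (\prod_i mu i ^+ M t i) (b t),
      forall k, a k = \sum_t b t k
    & c = \sum_t \prod_i phi i ^+ M t i * b t 0%N].

Lemma twist_cst c : twist (fun=> c) c.
Proof.
exists unit, (fun _ _ => 0%N), (fun _ _ => c).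
split=> [t|k|].
- rewrite big1 //; exists 1%N; apply/funext => k /=.
  by rewrite /shift_sub mul1r subrr.
- by rewrite big_const card_unit /= addr0.
- by rewrite big_const card_unit /= addr0 big1 ?mul1r.
Qed.

Lemma twistD a b c d :
  twist a c -> twist b d -> twist (fun k => a k + b k) (c + d).
Proof.
move=> [T [M [u [gu ua uc]]]] [T' [M' [v [gv vb vd]]]].
exists (T + T')%type, (fun t => match t with inl t => M t | inr t => M' t end).
exists (fun t => match t with inl t => u t | inr t => v t end).
split=> [[] t //|k|].
  by rewrite big_sumType /= ua vb.
by rewrite big_sumType /= uc vd.
Qed.

Lemma twistM a b c d :
  twist a c -> twist b d -> twist (fun k => a k * b k) (c * d).
Proof.
move=> [T [M [u [gu ua uc]]]] [T' [M' [v [gv vb vd]]]].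
exists (T * T')%type, (fun t i => M t.1 i + M' t.2 i)%N.
exists (fun t k => u t.1 k * v t.2 k).
have prodD (f : 'I_m -> F) t : \prod_i f i ^+ (M t.1 i + M' t.2 i) =
    \prod_i f i ^+ M t.1 i * \prod_i f i ^+ M' t.2 i.
  by rewrite -big_split; apply: eq_bigr => i _; rewrite exprD.
split=> [t|k|].
- by rewrite prodD; apply: geometricM.
- rewrite ua vb mulr_suml; under eq_bigr do rewrite mulr_sumr.
  by rewrite pair_bigA.
- rewrite uc vd mulr_suml; under eq_bigr do rewrite mulr_sumr.
  by rewrite pair_bigA; apply: eq_bigr => t _ /=; rewrite prodD mulrACA.
Qed.

Lemma twist_meval N (p : {mpoly F[N]}) (f : 'I_N -> nat -> F) (g : 'I_N -> F) :
  (forall i, twist (f i) (g i)) -> twist (fun k => p.@[fun i => f i k]) p.@[g].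
Proof.
move=> fg; elim/mpoly_ring_ind: p => [c|i|p q hp hq|p q hp hq].
- rewrite mevalC (_ : (fun _ => _) = fun=> c); first exact: twist_cst.
  by apply/funext => k; rewrite mevalC.
- rewrite mevalXU (_ : (fun _ => _) = f i); first exact: fg.
  by apply/funext => k; rewrite mevalXU.
- rewrite mevalD (_ : (fun _ => _) = (fun k => p.@[fun i => f i k]
      + q.@[fun i => f i k])); first exact: twistD.
  by apply/funext => k; rewrite mevalD.
- rewrite mevalM (_ : (fun _ => _) = (fun k => p.@[fun i => f i k]
      * q.@[fun i => f i k])); first exact: twistM.
  by apply/funext => k; rewrite mevalM.
Qed.

(** By the first hypothesis, replacing each [mu i] by [phi i] is well defined on monomial values, so
    all terms with the same eigenvalue are multiplied by the same factor. Grouped by eigenvalue, the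
    terms sum to 0 at 0 by independence. *)
Lemma twist0 (c : F) :
  (forall x y : 'I_m -> nat, \prod_i mu i ^+ x i = \prod_i mu i ^+ y i ->
     \prod_i phi i ^+ x i = \prod_i phi i ^+ y i) ->
  twist (fun=> 0) c -> c = 0.
Proof.
move=> rel [T [M [b [gb b0 ->]]]].
pose nu t := \prod_i mu i ^+ M t i.
pose V := undup [seq nu t | t : T].
pose a v k := \sum_(t | nu t == v) b t k.
have byV (f : T -> F) : \sum_t f t = \sum_(v <- V) \sum_(t | nu t == v) f t.
  under [RHS]eq_bigr do rewrite big_mkcond.
  rewrite exchange_big /=; apply: eq_bigr => t _.
  have tV : nu t \in V by rewrite mem_undup; exact: map_f (mem_enum _ _).
  rewrite (bigD1_seq _ tV (undup_uniq _)) /= eqxx big1 ?addr0 // => v.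
  by rewrite eq_sym => /negPf ->.
have aV v : v \in V -> a v 0%N = 0.
  apply: (@geometric_indep _ _ _ id a (undup_uniq _)) => [x y _ _ //|w _|k].
    apply: (@geometric_sum _ _ (fun t => nu t == w) w b) => t /eqP <-.
    exact: gb.
  by rewrite -(byV (b^~ k)) -b0.
rewrite byV big_seq big1 // => v vV.
have [t0 nut0] : exists t0, nu t0 = v.
  by move: vV; rewrite mem_undup => /mapP [t _ ->]; exists t.
transitivity (\prod_i phi i ^+ M t0 i * a v 0%N); last by rewrite aV ?mulr0.
rewrite mulr_sumr; apply: eq_bigr => t /eqP nut.
by congr (_ * _); apply: rel; rewrite -/(nu t) nut.
Qed.

End Twist.

(** The projections onto the generalized eigenspaces are polynomials in [h]: with [Q v] the product
    over the other eigenvalues, each is a term of a Bezout identity for [Q v ^+ N] and the power [N]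
    of ['X - v%:P]. The matrix size [N] bounds every multiplicity, so [P ^+ N] vanishes at [h], and
    all the identities reduce to that. *)
Lemma spectral_idempotents (F : closedFieldType) n (h : 'M[F]_n.+1) :
  exists m (mu : 'I_m -> F) (E : 'I_m -> 'M[F]_n.+1),
  [/\ injective mu,
      forall x, root (char_poly h) x -> exists i, mu i = x,
      [/\ \sum_i E i = 1, forall i, E i * E i = E i,
          forall i j, i != j -> E i * E j = 0 & forall i, E i != 0]
    & forall i, (h - (mu i)%:M) ^+ n.+1 * E i = 0].
Proof.
have [l chE] := char_poly_roots h.
pose s := undup l; pose N := n.+1.
pose P : {poly F} := \prod_(w <- s) ('X - w%:P).
have PN0 p : horner_mx h (P ^+ N * p) = 0.
  have dvdr r : {subset r <= s} -> \prod_(x <- r) ('X - x%:P) %| P ^+ size r.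
    elim: r => [|x r IHr] rs; first by rewrite big_nil dvd1p.
    rewrite big_cons exprS; apply: dvdp_mul.
      by rewrite dvdp_XsubCl /P root_prod_XsubC rs ?mem_head.
    by apply: IHr => y yr; apply: rs; rewrite inE yr orbT.
  have dvd : char_poly h %| P ^+ N.
    have := dvdr l; rewrite size_tuple -chE; apply.
    by move=> x; rewrite mem_undup.
  have /dvdpP [q ->] := dvdp_mulr p dvd.
  by rewrite rmorphM /= Cayley_Hamilton mulr0.
pose Q v : {poly F} := \prod_(w <- s | w != v) ('X - w%:P).
have us : uniq s by apply: undup_uniq.
have PQ v : v \in s -> P = ('X - v%:P) * Q v.
  by move=> vs; rewrite /P (bigD1_seq v).
have /choice [xy xyP] : forall v, exists xy : {poly F} * {poly F},
    xy.1 * Q v ^+ N + xy.2 * ('X - v%:P) ^+ N = 1.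
  move=> v; apply/Bezout_eq1_coprimepP; apply/coprimep_expl/coprimep_expr.
  rewrite coprimep_XsubC /root horner_prod prodf_seq_neq0.
  by apply/allP => w _; apply/implyP; rewrite hornerXsubC subr_eq0 eq_sym.
pose E0 v := horner_mx h ((xy v).1 * Q v ^+ N).
have EC v : 1 - E0 v = horner_mx h ((xy v).2 * ('X - v%:P) ^+ N).
  by apply/eqP; rewrite subr_eq addrC -rmorphD xyP rmorph1.
have Edisj v w : v \in s -> w \in s -> v != w -> E0 v * E0 w = 0.
  move=> vs ws vw; rewrite -rmorphM /=.
  have -> : Q w = ('X - v%:P) * \prod_(u <- rem v s | u != w) ('X - u%:P).
    by rewrite /Q (big_rem v) //= vw.
  set q := \prod_(_ <- _ | _) _.
  have -> : (xy v).1 * Q v ^+ N * ((xy w).1 * (('X - v%:P) * q) ^+ N) =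
      P ^+ N * ((xy v).1 * (xy w).1 * q ^+ N).
    by rewrite (PQ v vs) !exprMn; ring.
  exact: PN0.
have Eidem v : v \in s -> E0 v * E0 v = E0 v.
  move=> vs; apply/eqP; rewrite eq_sym -subr_eq0 -{1}[E0 v]mulr1 -mulrBr EC.
  rewrite -rmorphM /=.
  have -> : (xy v).1 * Q v ^+ N * ((xy v).2 * ('X - v%:P) ^+ N) =
      P ^+ N * ((xy v).1 * (xy v).2).
    by rewrite (PQ v vs) !exprMn; ring.
  by rewrite PN0.
have Eprod r : uniq r -> {subset r <= s} ->
    \prod_(v <- r) (1 - E0 v) = 1 - \sum_(v <- r) E0 v.
  elim: r => [|v r IHr] /= => [_ _|/andP [vr ur] rs].
    by rewrite !big_nil subr0.
  have vs : v \in s by apply: rs; apply: mem_head.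
  have {}rs : {subset r <= s} by move=> w wr; apply: rs; rewrite inE wr orbT.
  rewrite !big_cons IHr // mulrBr mulr1 mulrBl mul1r mulr_sumr.
  rewrite [X in _ - (_ - X)]big_seq [X in _ - (_ - X)]big1 => [|w wr].
    by rewrite subr0 opprD addrA.
  by rewrite Edisj // ?rs //; apply: contraNneq vr => ->.
have Esum : \sum_(v <- s) E0 v = 1.
  apply/eqP; rewrite eq_sym -subr_eq0 -Eprod //.
  have -> : \prod_(v <- s) (1 - E0 v) =
      horner_mx h (P ^+ N * \prod_(v <- s) (xy v).2).
    rewrite (eq_bigr _ (fun v _ => EC v)) -rmorph_prod /=.
    by congr horner_mx; rewrite big_split /= mulrC prodrXl.
  by rewrite PN0.
exists (size s), (tnth (in_tuple s)), (fun i => E0 (tnth (in_tuple s) i)).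
have ts i : tnth (in_tuple s) i \in s by apply: mem_tnth.
have inj : injective (tnth (in_tuple s)) by apply/tuple_uniqP.
split=> [||| i] //.
- move=> x; rewrite chE root_prod_XsubC -mem_undup => /(tnthP (in_tuple s)) [i ->].
  by exists i.
- split=> [|i|i j ij|i].
  + by rewrite -[RHS]Esum [in RHS]big_tnth.
  + exact: Eidem.
  + apply: Edisj => //; apply: contra ij => /eqP eij; apply/eqP.
    exact: inj.
  (* If the projection were 0, the Bezout identity would make [h - v%:M] invertible, although [v] is
     an eigenvalue. *)
  + apply/eqP => E0i; have := EC (tnth (in_tuple s) i).
    set v := tnth _ _ in E0i *; rewrite E0i subr0 mulrC rmorphM rmorphXn /=.
    rewrite rmorphB /= horner_mx_X horner_mx_C => h1.
    have : eigenvalue h v.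
      rewrite eigenvalue_root_char chE root_prod_XsubC.
      by have := ts i; rewrite mem_undup.
    case/eigenvalueP => u hu; apply/negP; rewrite negbK.
    have u0 : u *m (h - v%:M) = 0 by rewrite mulmxBr hu mul_mx_scalar subrr.
    rewrite -[u]mulmx1 -[1%:M]/(1 : 'M_n.+1) h1 exprS -!mulmxE.
    by rewrite !mulmxA u0 !mul0mx.
- set v := tnth _ _; have vs : v \in s by apply: ts.
  have -> : h - v%:M = horner_mx h ('X - v%:P).
    by rewrite rmorphB /= horner_mx_X horner_mx_C.
  rewrite -rmorphXn -rmorphM /=.
  have -> : ('X - v%:P) ^+ N * ((xy v).1 * Q v ^+ N) = P ^+ N * (xy v).1.
    by rewrite (PQ v vs) !exprMn; ring.
  exact: PN0.
Qed.

(** * Lattices of relations *)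

Lemma clear_denominators m n (A : 'M[rat]_(m, n)) :
  exists2 k : int, k != 0 & exists B : 'M[int]_(m, n), k%:~R *: A = map_mx intr B.
Proof.
pose k : int := \prod_(ij : 'I_m * 'I_n) denq (A ij.1 ij.2).
exists k; first by apply/prodf_neq0 => ij _; apply: denq_neq0.
exists (\matrix_(i, j) (numq (A i j) *
   \prod_(ij | ij != (i, j)) denq (A ij.1 ij.2))).
apply/matrixP => i j; rewrite !mxE /k (bigD1 (i, j)) //= !rmorphM /=.
by rewrite numqE; ring.
Qed.

Lemma intmx_inj m n : injective (map_mx intr : 'M[int]_(m, n) -> 'M[rat]_(m, n)).
Proof.
move=> A B /matrixP AB; apply/matrixP => i j; apply: (@intr_inj rat).
by have := AB i j; rewrite !mxE.
Qed.

Lemma scale_intmx_eq0 m n (c : int) (A : 'M[int]_(m, n)) :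
  c != 0 -> c *: A = 0 -> A = 0.
Proof.
move=> c0 /matrixP cA; apply/matrixP => i j; have := cA i j.
by rewrite !mxE => /eqP; rewrite mulf_eq0 (negPf c0) => /eqP.
Qed.

Lemma int_kernel_vector d r (A : 'M[int]_(d, r)) :
  (\rank (map_mx intr A : 'M[rat]_(d, r)) < d)%N ->
  exists2 v : 'rV[int]_d, v != 0 & v *m A = 0.
Proof.
set AQ := map_mx _ _ => rd.
have : kermx AQ != 0 by rewrite -mxrank_eq0 mxrank_ker subn_eq0 -ltnNge.
case/rowV0Pn => v /sub_kermxP vA v0.
have [k k0 [w vw]] := clear_denominators v; exists w.
  apply: contra v0 => /eqP w0; move: vw; rewrite w0 map_mx0 => /eqP.
  by rewrite scaler_eq0 intr_eq0 (negPf k0).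
by apply: intmx_inj; rewrite map_mxM -vw -scalemxAl vA scaler0 map_mx0.
Qed.

Section Saturation.
Variables (m : nat) (Rel : 'rV[int]_m -> Prop).
Hypothesis Rel0 : Rel 0.
Hypothesis RelB : forall x y, Rel x -> Rel y -> Rel (x - y).

Lemma Rel_scale (k : int) x : Rel x -> Rel (k *: x).
Proof.
move=> Rx; have RN y : Rel y -> Rel (- y) by rewrite -sub0r => ?; apply: RelB.
have RelD y z : Rel y -> Rel z -> Rel (y + z).
  by move=> Ry Rz; rewrite -[z]opprK; apply: RelB => //; apply: RN.
have nat_scale j : Rel (j%:Z *: x).
  by elim: j => [|j IHj]; rewrite ?scale0r // intS scalerDl scale1r; apply: RelD.
case: k => j; first exact: nat_scale.
by rewrite NegzE scaleNr; apply: RN.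
Qed.

Lemma Rel_mul k (z : 'rV[int]_k) (B : 'M[int]_(k, m)) :
  (forall i, Rel (row i B)) -> Rel (z *m B).
Proof.
move=> RB; rewrite mulmx_sum_row; elim/big_rec: _ => // i y _ Ry.
by rewrite addrC -[_ *: _]opprK -scaleNr; apply/RelB/Rel_scale.
Qed.

(** With [k] as large as possible, any further relation depends rationally on the rows of [B], and
    clearing denominators puts a multiple of it into their integer span. *)
Lemma maximal_relations : exists k (B : 'M[int]_(k, m)),
  [/\ forall i, Rel (row i B), row_free (map_mx intr B : 'M[rat]_(k, m))
    & forall x, Rel x -> exists2 c : int, c != 0 & exists z, c *: x = z *m B].
Proof.
pose good k := `[< exists B : 'M[int]_(k, m), (forall i, Rel (row i B)) /\
  row_free (map_mx intr B : 'M[rat]_(k, m)) >].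
have exg : exists k, good k.
  exists 0%N; apply/asboolP; exists 0; split=> [[] //|].
  by rewrite map_mx0 /row_free mxrank0.
have bnd k : good k -> (k <= m)%N.
  by case/asboolP => B [_ /eqP <-]; apply: rank_leq_col.
case: (ex_maxnP exg bnd) => k /asboolP [B [RB frB]] kmax.
exists k, B; split=> // x Rx.
pose BQ : 'M[rat]_(k, m) := map_mx intr B.
have xB : (map_mx intr x <= BQ)%MS.
  apply: contraT => xB; suff /kmax : good (k + 1)%N by rewrite addn1 ltnn.
  apply/asboolP; exists (col_mx B x); split=> [i|].
    case: (split_ordP i) => j ->.
      by rewrite rowKu.
    by rewrite rowKd row_id.
  rewrite map_col_mx /row_free eqn_leq rank_leq_row /= [X in (X <= _)%N]addn1.
  have : (BQ < BQ + map_mx intr x)%MS.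
    by rewrite ltmxE addsmxSl addsmx_sub submx_refl.
  by rewrite ltmxErank => /andP [_]; rewrite (eqP frB) addsmxE.
case/submxP: xB => D xD; have [c c0 [z zD]] := clear_denominators D.
exists c => //; exists z; apply: intmx_inj.
by rewrite map_mxZ map_mxM -zD xD -scalemxAl.
Qed.

(** The quotient of the integer lattice by the saturation of the relations is free; [W] is the
    projection onto it and [C] a section. In a Smith form [B = L *m D *m R] the saturation is
    spanned by the first [k] rows of [R], so [W] consists of the last columns of [invmx R] and [C]
    of the last rows of [R]. *)
Lemma saturated_quotient : exists r (W : 'M[int]_(m, r)) (C : 'M[int]_(r, m)),
  [/\ C *m W = 1%:M, forall x, Rel x -> x *m W = 0
    & forall x, x *m W = 0 -> exists2 c : int, c != 0 & Rel (c *: x)].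
Proof.
have [k [B [RB frB spanB]]] := maximal_relations.
have km : (k <= m)%N by move/eqP: frB => <-; apply: rank_leq_col.
have [L uL [R uR [d _ BE]]] := int_Smith_normal_form B.
set D := \matrix_(i, j) _ in BE.
have B_inj (v : 'rV[int]_k) : v *m B = 0 -> v = 0.
  move=> vB; apply/intmx_inj/(row_free_inj frB).
  by rewrite map_mx0 mul0mx -map_mxM vB map_mx0.
have d0 (i : 'I_k) : d`_i != 0.
  apply/eqP => di0; have := @B_inj (delta_mx 0 i *m invmx L).
  have rD : delta_mx 0 i *m D = 0 :> 'rV_m.
    by rewrite -rowE; apply/rowP => j; rewrite !mxE di0 mul0rn.
  rewrite BE !mulmxA mulmxKV // rD mul0mx => /(_ erefl).
  move/(congr1 (fun u => u *m L)).
  rewrite mulmxKV // mul0mx => /rowP /(_ i); rewrite !mxE !eqxx.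
  by move/eqP; rewrite oner_eq0.
have fP (j : 'I_(m - k)) : (k + j < m)%N by rewrite -ltn_subRL.
pose f j := Ordinal (fP j).
have f_inj : injective f.
  by move=> j j' /(congr1 val) /= /addnI ?; apply: val_inj.
exists (m - k)%N, (colsub f (invmx R)), (rowsub f R); split.
- apply/matrixP => i j.
  have := congr1 (fun M : 'M_m => M (f i) (f j)) (mulmxV uR).
  rewrite !mxE (inj_eq f_inj) => <-; apply: eq_bigr => l _.
  by rewrite !mxE.
- move=> x /spanB [c c0 [z cx]].
  apply: (scale_intmx_eq0 c0).
  have RW : R *m colsub f (invmx R) = colsub f 1%:M.
    apply/matrixP => i j.
    have := congr1 (fun M : 'M_m => M i (f j)) (mulmxV uR).
    rewrite !mxE => <-; apply: eq_bigr => l _; by rewrite !mxE.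
  have DW : D *m colsub f 1%:M = 0 :> 'M[int]_(k, m - k).
    apply/matrixP => i j; rewrite !mxE (bigD1 (f j)) //= !mxE eqxx mulr1.
    rewrite ltn_eqF ?(leq_trans (ltn_ord i)) ?leq_addr // mulr0n add0r.
    by apply: big1 => l lj; rewrite !mxE (negPf lj) mulr0.
  by rewrite scalemxAl cx BE -!mulmxA RW DW !mulmx0.
- move=> x xW; pose y := x *m invmx R.
  have yf j : y 0 (f j) = 0.
    have := congr1 (fun M : 'rV_(m - k) => M 0 j) xW.
    by rewrite !mxE => {2}<-; apply: eq_bigr => l _; rewrite !mxE.
  have yR : y *m R = x by rewrite mulmxKV.
  clearbody y; pose c : int := \prod_(i < k) d`_i.
  exists c; first by apply/prodf_neq0 => i _; apply: d0.
  pose z : 'rV[int]_k :=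
    \row_i ((\prod_(l < k | l != i) d`_l) * y 0 (widen_ord km i)).
  have zD : z *m D = c *: y.
    apply/rowP => l; rewrite !mxE; have [lk|kl] := ltnP l k; last first.
      have lf : (l - k < m - k)%N by rewrite ltn_sub2r // (leq_ltn_trans kl).
      have lE : l = f (Ordinal lf) by apply: val_inj; rewrite /= subnKC.
      have -> : y 0 l = 0 by rewrite lE yf.
      rewrite mulr0 big1 // => i _; rewrite !mxE ltn_eqF ?mulr0n ?mulr0 //.
      exact: leq_trans (ltn_ord i) kl.
    rewrite (bigD1 (Ordinal lk)) //= !mxE eqxx mulr1n [X in _ + X]big1 ?addr0 => [|i il].
      rewrite /c [in RHS](bigD1 (Ordinal lk)) //= mulrAC [_ * d`_l]mulrC.
      congr (_ * _).
      by congr (y 0 _); apply: val_inj.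
    rewrite !mxE; case: eqP => [il'|_]; last by rewrite mulr0n mulr0.
    by case/eqP: il; apply: val_inj.
  have -> : c *: x = z *m invmx L *m B.
    rewrite BE !mulmxA mulmxKV // zD -scalemxAl.
    by rewrite yR.
  exact: Rel_mul.
Qed.
End Saturation.

(** * Tori given by weights *)

Definition posz_part (k : int) : nat := if k is Posz a then a else 0%N.
Definition negz_part (k : int) : nat := if k is Negz a then a.+1 else 0%N.

Lemma int_parts (k : int) : k = (posz_part k)%:Z - (negz_part k)%:Z.
Proof. by case: k => a /=; rewrite ?subr0 // NegzE sub0r. Qed.

Section Monomials.
Variables (F : fieldType) (d : nat).
Implicit Types (w v : 'rV[int]_d) (s t : 'rV[F]_d).

Definition nonzero t : Prop := forall j, t 0 j != 0.

Definition mon w t : F := \prod_j t 0 j ^ w 0 j.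

Definition rmul s t : 'rV[F]_d := \row_j (s 0 j * t 0 j).

Definition rinv t : 'rV[F]_d := map_mx (fun x => x^-1) t.

Lemma nonzero_rmul s t : nonzero s -> nonzero t -> nonzero (rmul s t).
Proof. by move=> s0 t0 j; rewrite mxE mulf_neq0. Qed.

Lemma nonzero_rinv t : nonzero t -> nonzero (rinv t).
Proof. by move=> t0 j; rewrite mxE invr_eq0. Qed.

Lemma nonzero1 : nonzero (const_mx 1).
Proof. by move=> j; rewrite mxE oner_eq0. Qed.

Lemma mon_neq0 w t : nonzero t -> mon w t != 0.
Proof. by move=> t0; apply/prodf_neq0 => j _; rewrite expfz_neq0. Qed.

Lemma mon_rmul w s t : nonzero s -> nonzero t ->
  mon w (rmul s t) = mon w s * mon w t.
Proof.
move=> s0 t0; rewrite -big_split; apply: eq_bigr => j _ /=.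
by rewrite mxE expfzMl.
Qed.

Lemma mon_rinv w t : mon w (rinv t) = (mon w t)^-1.
Proof.
by rewrite -prodfV; apply: eq_bigr => j _; rewrite mxE expfV.
Qed.

Lemma mon_parts w t : nonzero t -> mon w t =
  (\prod_j t 0 j ^+ posz_part (w 0 j)) / \prod_j t 0 j ^+ negz_part (w 0 j).
Proof.
move=> t0; rewrite -prodf_div; apply: eq_bigr => j _.
by rewrite {1}(int_parts (w 0 j)) expfzDr // -exprnN.
Qed.

Lemma mon1 w : mon w (const_mx 1) = 1.
Proof. by apply: big1 => j _; rewrite mxE exp1rz. Qed.

Lemma mon0 t : mon 0 t = 1.
Proof. by apply: big1 => j _; rewrite mxE expr0z. Qed.

Lemma monD w v t : nonzero t -> mon (w + v) t = mon w t * mon v t.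
Proof.
move=> t0; rewrite -big_split; apply: eq_bigr => j _ /=.
by rewrite mxE expfzDr.
Qed.

Lemma monZ (k : int) w t : mon (k *: w) t = mon w t ^ k.
Proof.
rewrite /mon (big_morph (fun x : F => x ^ k) (id1 := 1) (op1 := *%R)).
- by apply: eq_bigr => j _; rewrite mxE mulrC exprz_exp.
- by move=> x y; rewrite expfzMl.
- by rewrite exp1rz.
Qed.

Lemma mon_sum (I : finType) (w : I -> 'rV[int]_d) t : nonzero t ->
  mon (\sum_i w i) t = \prod_i mon (w i) t.
Proof.
move=> t0; apply: (big_morph (fun w => mon w t)); last exact: mon0.
by move=> v u; apply: monD.
Qed.

Lemma mon_delta j t : mon (delta_mx 0 j) t = t 0 j.
Proof.
rewrite /mon (bigD1 j) //= big1 ?mulr1 => [|l lj]; rewrite mxE eqxx.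
  by rewrite eqxx expr1z.
by rewrite (negPf lj) expr0z.
Qed.

Lemma mon_mul k (c : 'rV[int]_k) (W : 'M[int]_(k, d)) t : nonzero t ->
  mon (c *m W) t = \prod_i mon (row i W) t ^ c 0 i.
Proof.
move=> t0; rewrite mulmx_sum_row mon_sum //.
by apply: eq_bigr => i _; rewrite monZ.
Qed.

Definition torus_pt t : 'M[F]_(d + d) := diag_mx (row_mx t (rinv t)).

Lemma torus_ptM s t : torus_pt (rmul s t) = torus_pt s *m torus_pt t.
Proof.
rewrite mulmx_diag; congr diag_mx; apply/rowP => j; rewrite [RHS]mxE.
case: (split_ordP j) => k ->; first by rewrite !row_mxEl mxE.
by rewrite !row_mxEr !mxE invfM.
Qed.

Lemma torus_pt_inj : injective torus_pt.
Proof.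
move=> s t /matrixP st; apply/rowP => j.
have := st (lshift d j) (lshift d j).
by rewrite mxE [RHS]mxE eqxx !mulr1n !row_mxEl.
Qed.

(* An exponent in [int] is made polynomial by passing both [x] and its inverse. *)
Definition zpow (x x' : F) (k : int) : F :=
  match k with Posz n => x ^+ n | Negz n => x' ^+ n.+1 end.

Lemma zpowE (x : F) k : zpow x x^-1 k = x ^ k.
Proof. by case: k => n //=; rewrite exprVn. Qed.

Lemma pfun_zpow X N (c : X -> 'I_N -> F) f f' k :
  pfun c f -> pfun c f' -> pfun c (fun x => zpow (f x) (f' x) k).
Proof. by move=> hf hf'; case: k => j; apply: pfunX. Qed.

End Monomials.

Section WeightTorus.
Variables (F : fieldType) (n m d : nat) (E : 'I_m -> 'M[F]_n).
Hypothesis E_sum : \sum_i E i = 1%:M.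
Hypothesis E_idem : forall i, E i *m E i = E i.
Hypothesis E_orth : forall i j, i != j -> E i *m E j = 0.
Hypothesis E_neq0 : forall i, E i != 0.
Variables (W : 'M[int]_(m, d)) (C : 'M[int]_(d, m)).
Hypothesis CW : C *m W = 1%:M.

Definition weight_mx t : 'M[F]_n := \sum_i mon (row i W) t *: E i.

Definition weight_torus : set 'M[F]_n :=
  [set A | exists2 t, nonzero t & A = weight_mx t].

Hypothesis det1 : forall t, nonzero t -> \det (weight_mx t) = 1.

Lemma comb_mulE (a : 'I_m -> F) j :
  (\sum_i a i *: E i) *m E j = a j *: E j.
Proof.
rewrite mulmx_suml (bigD1 j) //= big1 ?addr0 => [|i ij].
  by rewrite -scalemxAl E_idem.
by rewrite -scalemxAl E_orth ?scaler0.
Qed.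

Lemma weight_mxM s t : nonzero s -> nonzero t ->
  weight_mx (rmul s t) = weight_mx s *m weight_mx t.
Proof.
move=> s0 t0; rewrite [in RHS]/weight_mx mulmx_sumr; apply: eq_bigr => j _.
by rewrite -scalemxAr comb_mulE scalerA mon_rmul // mulrC.
Qed.

Lemma weight_mx1 : weight_mx (const_mx 1) = 1%:M.
Proof. by rewrite -E_sum; apply: eq_bigr => i _; rewrite mon1 scale1r. Qed.

Lemma weight_mxV t : nonzero t -> invmx (weight_mx t) = weight_mx (rinv t).
Proof.
move=> t0; have ut : weight_mx t \in unitmx by rewrite unitmxE det1 ?unitr1.
rewrite -[RHS](mulKmx ut) -weight_mxM //; last exact: nonzero_rinv.
rewrite (_ : rmul t (rinv t) = const_mx 1) ?weight_mx1 ?mulmx1 //.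
by apply/rowP => j; rewrite !mxE mulfV.
Qed.

Lemma weight_mx_adj t : nonzero t -> \adj (weight_mx t) = weight_mx (rinv t).
Proof.
move=> t0; rewrite -weight_mxV // /invmx unitmxE det1 // unitr1.
by rewrite invr1 scale1r.
Qed.

(** Multiplying by [E i] isolates the weight [i], and dividing by a nonzero entry of [E i] extracts
    it. The inverse weight comes from the adjugate, a polynomial map that inverts matrices of
    determinant 1. *)
Lemma weight_coordinates : exists x x' : 'I_m -> 'M[F]_n -> F,
  [/\ forall i, pfun (@entries F n) (x i), forall i, pfun (@entries F n) (x' i)
    & forall i t, nonzero t -> x i (weight_mx t) = mon (row i W) t /\
        x' i (weight_mx t) = (mon (row i W) t)^-1].
Proof.
have /choice [ab abP] : forall i, exists ab : 'I_n * 'I_n, E i ab.1 ab.2 != 0.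
  by move=> i; have /matrix0Pn [a [b ?]] := E_neq0 i; exists (a, b).
pose y i (A : 'M[F]_n) := (A *m E i) (ab i).1 (ab i).2 / E i (ab i).1 (ab i).2.
have y_weight i t : y i (weight_mx t) = mon (row i W) t.
  by rewrite /y comb_mulE mxE mulfK.
have py G i : mxpfun (@entries F n) G -> pfun (@entries F n) (fun A => y i (G A)).
  move=> hG; apply: pfunM (pfun_cst _ _).
  exact: (mxpfunM hG (mxpfun_cst _ (E i))).
exists y, (fun i A => y i (\adj A)); split=> [i|i|i t t0].
- exact: py (@mxpfun_id F n).
- exact/py/mxpfun_adj/mxpfun_id.
- by rewrite weight_mx_adj // !y_weight mon_rinv.
Qed.

(** By [CW] the coordinates of [t] are Laurent monomials in the weights, hence polynomial in the
    weights and their inverses. This inverts the parametrization and also provides equations for the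
    torus. *)
Lemma weight_torus_of_dim : torus_of_dim d weight_torus.
Proof.
have [x [x' [px px' xE]]] := weight_coordinates.
pose t j (A : 'M[F]_n) := \prod_i zpow (x i A) (x' i A) (C j i).
pose t' j (A : 'M[F]_n) := \prod_i zpow (x' i A) (x i A) (C j i).
have pt j : pfun (@entries F n) (t j).
  by apply: pfun_prod => i _; apply: pfun_zpow.
have pt' j : pfun (@entries F n) (t' j).
  by apply: pfun_prod => i _; apply: pfun_zpow.
have tE j u : nonzero u -> t j (weight_mx u) = u 0 j.
  move=> u0; rewrite -mon_delta -[delta_mx 0 j]mulmx1 -CW mulmxA -rowE mon_mul //.
  by apply: eq_bigr => i _; have [-> ->] := xE i u u0; rewrite zpowE mxE.
have t'E j u : nonzero u -> t' j (weight_mx u) = (u 0 j)^-1.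
  move=> u0; rewrite -tE // -prodfV.
  apply: eq_bigr => i _; have [-> ->] := xE i u u0.
  by rewrite zpowE -[X in zpow _ X]invrK zpowE expfV.
pose G (u u' : 'rV[F]_d) : 'M[F]_n :=
  \sum_i (\prod_j zpow (u 0 j) (u' 0 j) (W i j)) *: E i.
have GE u : G u (rinv u) = weight_mx u.
  apply: eq_bigr => i _; congr (_ *: _); apply: eq_bigr => j _.
  by rewrite !mxE zpowE.
have pG X N (c : X -> 'I_N -> F) (u u' : X -> 'rV[F]_d) :
    mxpfun c u -> mxpfun c u' -> mxpfun c (fun x => G (u x) (u' x)).
  move=> hu hu'; apply: mxpfun_sum => i _; apply: mxpfunZ (mxpfun_cst _ _).
  by apply: pfun_prod => j _; apply: pfun_zpow.
pose tt A : 'rV[F]_d := \row_j t j A; pose tt' A : 'rV[F]_d := \row_j t' j A.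
have ptt : mxpfun (@entries F n) tt.
  by move=> i j; apply: eq_pfun (pt j) => A; rewrite mxE.
have ptt' : mxpfun (@entries F n) tt'.
  by move=> i j; apply: eq_pfun (pt' j) => A; rewrite mxE.
have ttE u : nonzero u -> tt (weight_mx u) = u.
  by move=> u0; apply/rowP => j; rewrite mxE tE.
have tt'E u : nonzero u -> tt' (weight_mx u) = rinv u.
  by move=> u0; apply/rowP => j; rewrite !mxE t'E.
have clT : zariski_closed weight_torus.
  (* The equations say that the recovered coordinates and recovered inverses are inverse to each
     other, and that [A] is the point they parametrize. *)
  pose f (e : 'I_n * 'I_n + 'I_d) (A : 'M[F]_n) : F := match e with
    | inl ab => G (tt A) (tt' A) ab.1 ab.2 - A ab.1 ab.2
    | inr j => t j A * t' j A - 1 end.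
  have -> : weight_torus = [set A | forall e, f e A = 0].
    apply/seteqP; split=> A.
      case=> u u0 -> [[a b]|j] /=.
        by rewrite ttE // tt'E // GE subrr.
      by rewrite tE // t'E // mulfV // subrr.
    move=> fA; have tt1 j : t j A * t' j A = 1.
      by apply/eqP; rewrite -subr_eq0; apply/eqP; apply: (fA (inr j)).
    have u0 : nonzero (tt A).
      by move=> j; rewrite mxE; apply: contra_eq_neq (tt1 j) => ->; rewrite mul0r eq_sym oner_eq0.
    exists (tt A) => //; rewrite -GE.
    have -> : rinv (tt A) = tt' A.
      apply/rowP => j; rewrite !mxE; have := u0 j; rewrite mxE => tj0.
      by rewrite -[RHS](mulKf tj0) tt1 mulr1.
    apply/matrixP => a b; apply/eqP; rewrite eq_sym -subr_eq0; apply/eqP.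
    exact: (fA (inl (a, b))).
  apply: zariski_closed_zeros => -[[a b]|j] /=.
    by apply: pfunB; [apply: pG | apply: mxpfun_id].
  by apply: pfunB (pfun_cst _ _); apply: pfunM.
split.
  split=> //; first by move=> _ [u u0 ->]; apply: det1.
  split.
  - by move=> _ [u u0 ->]; rewrite /= unitmxE det1 // unitr1.
  - by exists (const_mx 1); [apply: nonzero1 | rewrite weight_mx1].
  - move=> _ _ [u u0 ->] [v v0 ->]; exists (rmul u v); first exact: nonzero_rmul.
    by rewrite weight_mxM.
  - move=> _ [u u0 ->]; exists (rinv u); first exact: nonzero_rinv.
    by rewrite weight_mxV.
pose l (D : 'M[F]_(d + d)) : 'rV[F]_d := \row_j D (lshift d j) (lshift d j).
pose r (D : 'M[F]_(d + d)) : 'rV[F]_d := \row_j D (rshift d j) (rshift d j).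
have lE u v : l (diag_mx (row_mx u v)) = u.
  by apply/rowP => j; rewrite mxE mxE eqxx mulr1n row_mxEl.
have rE u v : r (diag_mx (row_mx u v)) = v.
  by apply/rowP => j; rewrite mxE mxE eqxx mulr1n row_mxEr.
exists (fun D => G (l D) (r D)), (fun A => diag_mx (row_mx (tt A) (tt' A))).
split.
- apply/polynomial_mapP; apply: pG => i j.
    apply: eq_pfun (@mxpfun_id F _ (lshift d j) (lshift d j)) => D.
    by rewrite mxE.
  apply: eq_pfun (@mxpfun_id F _ (rshift d j) (rshift d j)) => D.
  by rewrite mxE.
- apply/polynomial_mapP => i j.
  apply: (@eq_pfun _ _ _ _ _ (fun A => row_mx (tt A) (tt' A) 0 i *+ (i == j))).
    by move=> A; rewrite mxE.
  case: (i == j); last by apply: pfun_cst.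
  case: (split_ordP i) => k ->.
    by apply: eq_pfun (ptt 0 k) => A; rewrite mulr1n row_mxEl.
  by apply: eq_pfun (ptt' 0 k) => A; rewrite mulr1n row_mxEr.
- move=> _ [u [u0 ->]]; rewrite lE rE GE; split; first by exists u.
  by rewrite ttE // tt'E.
- move=> _ [u u0 ->]; rewrite lE rE ttE // tt'E // GE; split=> //.
  by exists u; split.
- move=> _ _ [u [u0 ->]] [v [v0 ->]].
  rewrite !lE !rE !GE -weight_mxM // -/(torus_pt u) -/(torus_pt v) -torus_ptM.
  by rewrite lE rE GE.
Qed.

End WeightTorus.

(** * Weights of a torus *)

Section IndependentPoint.
Variable F : fieldType.
Hypothesis pchar0 : [pchar F] =i pred0.

Lemma natr_inj0 : injective (fun n : nat => n%:R : F).
Proof.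
have F0 := (pcharf0P F).1 pchar0.
move=> a b; wlog ab : a b / (a <= b)%N => [h|/= /esym/eqP].
  by case: (leqP a b) => [/h//|/ltnW /h h' /esym /h' ->].
by rewrite -subr_eq0 -natrB // F0 subn_eq0 => ba; apply/eqP; rewrite eqn_leq ab.
Qed.

Lemma expz_nat_eq1 (p : nat) (k : int) : (1 < p)%N -> (p%:R : F) ^ k = 1 -> k = 0.
Proof.
move=> p1; have nat_case j : (p%:R : F) ^+ j = 1 -> j = 0%N.
  rewrite -natrX -[1]/(1%:R) => /natr_inj0/eqP.
  by rewrite -[X in _ == X](expn0 p) eqn_exp2l // => /eqP.
case: k => j; first by move/nat_case ->.
by rewrite NegzE -exprnN => /(congr1 GRing.inv); rewrite invrK invr1 => /nat_case.
Qed.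

Lemma primes_increasing : exists2 p : nat -> nat, forall j, prime (p j) &
  forall i j, (i < j)%N -> (p i < p j)%N.
Proof.
pose p := fix p j := if j is k.+1 then sval (prime_above (p k)) else 2%N.
have pS j : (p j < p j.+1)%N by rewrite /=; case: prime_above.
exists p; first by case=> // j /=; case: prime_above.
by move=> i j; elim: j => // j IHj; rewrite ltnS leq_eqVlt => /predU1P [->|/IHj]
  ; [apply: pS | move/ltn_trans; apply].
Qed.

(** Distinct primes are taken as coordinates. In characteristic 0 a monomial relation between them
    is an equality of natural numbers, and unique factorisation compares the exponents. *)
Lemma independent_point d : exists2 t : 'rV[F]_d, nonzero t &
  forall w, mon w t = 1 -> w = 0.
Proof.
have [p pr_p inc_p] := primes_increasing.
have p0 j : (p j)%:R != 0 :> F.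
  by rewrite -[0]/(0%:R) (inj_eq natr_inj0) -lt0n prime_gt0.
have inj_p i j : p i = p j -> i = j.
  by move=> pij; case: (ltngtP i j) => // /inc_p; rewrite pij ltnn.
exists (\row_j (p j)%:R) => [j|w]; first by rewrite mxE.
have -> : mon w (\row_j (p j)%:R) = (\prod_(j < d) p j ^ posz_part (w 0%R j))%N%:R
    / (\prod_(j < d) p j ^ negz_part (w 0%R j))%N%:R :> F.
  rewrite mon_parts => [|j]; last by rewrite mxE.
  by rewrite !natr_prod; congr (_ / _); apply: eq_bigr => j _; rewrite mxE natrX.
have prod0 (e : 'I_d -> nat) : (\prod_(j < d) p j ^ e j)%N%:R != 0 :> F.
  rewrite natr_prod; apply/prodf_neq0 => j _; by rewrite natrX expf_neq0.
move=> /(canRL (mulfVK (prod0 _))); rewrite mul1r => /natr_inj0 eq_prod.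
have logp (e : 'I_d -> nat) (j : 'I_d) : logn (p j) (\prod_(l < d) p l ^ e l) = e j.
  have [_ ->] : (0 < \prod_(l < d) p l ^ e l)%N /\
      logn (p j) (\prod_(l < d) p l ^ e l) = (\sum_(l < d) logn (p j) (p l ^ e l))%N.
    elim/big_rec2: _ => [|l x y _ [y0 <-]]; first by rewrite logn1.
    have pl0 : (0 < p l ^ e l)%N by rewrite expn_gt0 prime_gt0.
    by rewrite muln_gt0 pl0 y0 lognM.
  rewrite (bigD1 j) //= pfactorK // big1 ?addn0 // => l lj.
  rewrite lognX logn_prime //; case: eqP => [/inj_p jl|]; last by rewrite muln0.
  by case/eqP: lj; apply: val_inj.
apply/rowP => j; rewrite mxE (int_parts (w 0 j)).
by rewrite -(logp (fun j => posz_part (w 0%R j))) eq_prod logp subrr.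
Qed.
End IndependentPoint.

(** * Laurent expansions and representations of tori *)

Section LaurentMaps.
Variables (F : fieldType) (d : nat).

(** Values in a module cover matrix functions and, through [F^o], scalar ones. Only points with
    nonzero coordinates count, and weights may repeat in [s]. *)
Definition laurent (V : lmodType F) (g : 'rV[F]_d -> V) : Prop :=
  exists s : seq ('rV[int]_d * V), forall t, nonzero t ->
    g t = \sum_(x <- s) mon x.1 t *: x.2.

Lemma eq_laurent (V : lmodType F) (g h : 'rV[F]_d -> V) :
  (forall t, nonzero t -> g t = h t) -> laurent h -> laurent g.
Proof. by move=> gh [s hs]; exists s => t t0; rewrite gh ?hs. Qed.

Lemma laurent_mon (V : lmodType F) w (v : V) : laurent (fun t => mon w t *: v).
Proof. by exists [:: (w, v)] => t _; rewrite big_seq1. Qed.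

Lemma laurent_cst (V : lmodType F) (v : V) : laurent (fun=> v).
Proof.
by apply: eq_laurent (laurent_mon 0 v) => t _; rewrite mon0 scale1r.
Qed.

Lemma laurentD (V : lmodType F) (g h : 'rV[F]_d -> V) :
  laurent g -> laurent h -> laurent (fun t => g t + h t).
Proof.
by move=> [s gs] [s' hs]; exists (s ++ s') => t t0; rewrite big_cat gs ?hs.
Qed.

Lemma laurent_sum (V : lmodType F) (I : Type) (r : seq I)
    (g : I -> 'rV[F]_d -> V) :
  (forall i, laurent (g i)) -> laurent (fun t => \sum_(i <- r) g i t).
Proof.
move=> hg; elim: r => [|i r IHr].
  by apply: eq_laurent (laurent_cst 0) => t _; rewrite big_nil.
by apply: eq_laurent (laurentD (hg i) IHr) => t _; rewrite big_cons.
Qed.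

Lemma laurentZ (V : lmodType F) (g : 'rV[F]_d -> F^o) (v : V) :
  laurent g -> laurent (fun t => g t *: v).
Proof.
move=> [s gs]; exists [seq (x.1, x.2 *: v) | x <- s] => t t0.
rewrite big_map gs // scaler_suml; apply: eq_bigr => x _.
by rewrite scalerA.
Qed.

Lemma laurentM (g h : 'rV[F]_d -> F^o) :
  laurent g -> laurent h -> laurent (fun t => (g t : F) * h t : F^o).
Proof.
move=> [s gs] [s' hs].
exists [seq (x.1 + y.1, (x.2 : F) * y.2 : F^o) | x <- s, y <- s'] => t t0.
rewrite big_allpairs_dep gs // hs // mulr_suml; apply: eq_bigr => x _.
rewrite mulr_sumr; apply: eq_bigr => y _ /=.
by rewrite monD // /GRing.scale /= mulrACA.
Qed.

Lemma laurent_pfun (f : 'M[F]_(d + d) -> F) :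
  pfun (@entries F _) f -> laurent (fun t => f (torus_pt t) : F^o).
Proof.
move=> [p fp]; apply: (@eq_laurent _ _ (fun t => p.@[entries (torus_pt t)] : F^o)).
  by move=> t _; rewrite fp.
elim/mpoly_ring_ind: p {f fp} => [c|k|p q hp hq|p q hp hq].
- by apply: eq_laurent (laurent_cst (c : F^o)) => t _; rewrite mevalC.
- case/mxvec_indexP: k => i j.
  apply: (@eq_laurent _ _ (fun t => row_mx t (rinv t) 0 i *+ (i == j) : F^o)).
    by move=> t _; rewrite mevalXU /entries mxvecE mxE.
  case: (i == j); last exact: laurent_cst.
  case: (split_ordP i) => l ->.
    apply: eq_laurent (laurent_mon (delta_mx 0 l) (1 : F^o)) => t _.
    by rewrite mulr1n row_mxEl mon_delta [RHS]mulr1.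
  apply: eq_laurent (laurent_mon (-1 *: delta_mx 0 l) (1 : F^o)) => t _.
  by rewrite mulr1n row_mxEr mxE monZ mon_delta [RHS]mulr1.
- by apply: eq_laurent (laurentD hp hq) => t _; rewrite mevalD.
- by apply: eq_laurent (laurentM hp hq) => t _; rewrite mevalM.
Qed.

Lemma laurent_mxpfun m n (f : 'M[F]_(d + d) -> 'M[F]_(m, n)) :
  mxpfun (@entries F _) f -> laurent (fun t => f (torus_pt t)).
Proof.
move=> hf; apply: (@eq_laurent _ _
    (fun t => \sum_i \sum_j f (torus_pt t) i j *: delta_mx i j)).
  by move=> t _; apply: matrix_sum_delta.
apply: laurent_sum => i; apply: laurent_sum => j.
exact: laurentZ (laurent_pfun (hf i j)).
Qed.

Lemma laurent_reduced (V : lmodType F) (g : 'rV[F]_d -> V) : laurent g ->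
  exists (r : seq 'rV[int]_d) (c : 'rV[int]_d -> V),
  [/\ uniq r, forall w, w \in r -> c w != 0
    & forall t, nonzero t -> g t = \sum_(w <- r) mon w t *: c w].
Proof.
move=> [s gs]; pose c w := \sum_(x <- s | x.1 == w) x.2.
pose r := undup [seq x.1 | x <- s].
exists [seq w <- r | c w != 0], c; split=> [|w|t t0].
- by rewrite filter_uniq ?undup_uniq.
- by rewrite mem_filter => /andP [].
rewrite gs // big_filter [RHS]big_mkcond /=.
transitivity (\sum_(w <- r) mon w t *: c w); last first.
  by apply: eq_bigr => w _; case: eqP => // ->; rewrite scaler0.
under [RHS]eq_bigr do rewrite scaler_sumr big_mkcond.
rewrite exchange_big /= big_seq [RHS]big_seq; apply: eq_bigr => x xs.
have xr : x.1 \in r by rewrite mem_undup map_f.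
rewrite (bigD1_seq _ xr (undup_uniq _)) /= eqxx big1 ?addr0 // => w.
by rewrite eq_sym => /negPf ->.
Qed.

Hypothesis pchar0 : [pchar F] =i pred0.

Lemma power_pt_indep (t0 : 'rV[F]_d) m n (r : seq 'rV[int]_d)
    (c : 'rV[int]_d -> 'M[F]_(m, n)) : nonzero t0 ->
  (forall w, mon w t0 = 1 -> w = 0) -> uniq r ->
  (forall k : nat, \sum_(w <- r) mon w t0 ^+ k *: c w = 0) ->
  forall w, w \in r -> c w = 0.
Proof.
move=> nz0 ind0 ur sum0 w wr; apply/matrixP => i j; rewrite mxE.
rewrite -[LHS]mul1r -(expr0 (mon w t0)).
pose a w k := mon w t0 ^+ k * c w i j.
apply: (@geometric_indep _ _ r (fun w => mon w t0) a ur) wr => [v u _ _ /= vu|v _|k].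
- apply/eqP; rewrite -subr_eq0; apply/eqP/ind0.
  by rewrite monD // -scaleN1r monZ vu mulfV ?mon_neq0.
- exists 1%N; apply/funext => k /=.
  by rewrite /shift_sub /a exprS mulrA subrr.
- have := congr1 (fun M : 'M_(m, n) => M i j) (sum0 k).
  by rewrite mxE summxE => {2}<-; apply: eq_bigr => v _; rewrite mxE.
Qed.

(** The [E i] are the coefficients of the reduced Laurent expansion of [phi]. Multiplicativity,
    compared first in one argument and then in the other along the powers of an independent point
    [t0], shows that they are orthogonal idempotents. *)
Lemma torus_rep_weights n (phi : 'rV[F]_d -> 'M[F]_n) : laurent phi ->
  (forall s t, nonzero s -> nonzero t -> phi (rmul s t) = phi s *m phi t) ->
  exists m (W : 'M[int]_(m, d)) (E : 'I_m -> 'M[F]_n),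
  [/\ forall i, E i != 0, forall i, E i *m E i = E i,
      forall i j, i != j -> E i *m E j = 0
    & forall t, nonzero t -> phi t = \sum_i mon (row i W) t *: E i].
Proof.
move=> /laurent_reduced [r [c [ur c0 phiE]]] phiM.
have [t0 nz0 ind0] := independent_point pchar0 d.
pose pt k := iter k (rmul t0) (const_mx 1).
have nzpt k : nonzero (pt k).
  elim: k => [|k IHk]; [exact: nonzero1 | exact: nonzero_rmul].
have mon_pt w k : mon w (pt k) = mon w t0 ^+ k.
  elim: k => [|k IHk]; first by rewrite mon1.
  by rewrite exprS -IHk mon_rmul.
have indep := @power_pt_indep t0 n n r _ nz0 ind0 ur.
have cM w v : w \in r -> v \in r -> c w *m c v = (if w == v then c w else 0).
  move=> wr vr.
  have step1 l u : u \in r ->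
      mon u t0 ^+ l *: c u = \sum_(x <- r) mon x t0 ^+ l *: (c u *m c x).
    move=> ur'; apply/eqP; rewrite -subr_eq0; apply/eqP; move: u ur'.
    apply: indep => k; have := phiM _ _ (nzpt k) (nzpt l).
    rewrite !phiE //; last exact: nonzero_rmul.
    move/eqP; rewrite -subr_eq0 mulmx_suml -sumrB => /eqP eq0; rewrite -[RHS]eq0.
    apply: eq_bigr => u _; rewrite scalerBr mon_rmul // !mon_pt scalerA.
    congr (_ - _); rewrite mulmx_sumr scaler_sumr; apply: eq_bigr => x _.
    by rewrite -scalemxAl -scalemxAr mon_pt.
  apply/eqP; rewrite -subr_eq0; apply/eqP; move: v vr; apply: indep => k.
  under eq_bigr do rewrite scalerBr.
  rewrite sumrB -step1 // (bigD1_seq w) //= eqxx big1 ?addr0 ?subrr // => v.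
  by rewrite eq_sym => /negPf ->; rewrite scaler0.
pose R := in_tuple r.
have ws i : tnth R i \in r by apply: mem_tnth.
have injR : injective (tnth R) by apply/tuple_uniqP.
exists (size r), (\matrix_i tnth R i), (fun i => c (tnth R i)); split.
- by move=> i; apply: c0.
- by move=> i; rewrite cM // eqxx.
- by move=> i j ij; rewrite cM // (inj_eq injR) (negPf ij).
- move=> t t_nz; rewrite phiE // [LHS](big_tnth _ _ r); apply: eq_bigr => i _.
  by rewrite rowK.
Qed.

End LaurentMaps.

(** Nonzero row vectors fixed by the different [E i] are linearly independent, as [E j] isolates the
    coefficient of the [j]-th one. *)
Lemma orthogonal_idempotents_le (F : fieldType) n m (E : 'I_m -> 'M[F]_n) :
  (forall i, E i != 0) -> (forall i, E i *m E i = E i) ->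
  (forall i j, i != j -> E i *m E j = 0) -> (m <= n)%N.
Proof.
move=> E0 Ei Eo.
have /choice [u uE] : forall i, exists u : 'rV[F]_n, u != 0 /\ u *m E i = u.
  move=> i; have /rowV0Pn [u /submxP [v uv] u0] : E i != 0 by [].
  by exists u; split=> //; rewrite uv -mulmxA Ei.
pose U : 'M[F]_(m, n) := \matrix_i u i.
suff /eqP <- : row_free U by apply: rank_leq_col.
apply: inj_row_free => v vU; apply/rowP => j; rewrite mxE.
have := congr1 (mulmx^~ (E j)) vU; rewrite /= mul0mx [v *m U]mulmx_sum_row mulmx_suml.
rewrite (bigD1 j) //= big1 => [|i ij].
  rewrite rowK -scalemxAl (uE j).2 addr0 => /eqP.
  by rewrite scaler_eq0 (negPf (uE j).1) orbF => /eqP.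
by rewrite rowK -(uE i).2 -scalemxAl -mulmxA Eo // mulmx0 scaler0.
Qed.

(** * Dimensions of tori and rank *)

(** All rows of [W] are trivial on the one-parameter subgroup with exponents [v]. Its value at 2 is
    not the identity, since 2 has infinite order in characteristic 0. *)
Lemma kernel_point (F : fieldType) m d (W : 'M[int]_(m, d)) (v : 'rV[int]_d) :
  [pchar F] =i pred0 -> v != 0 -> v *m W^T = 0 ->
  exists t : 'rV[F]_d, [/\ nonzero t, t != const_mx 1 & forall i, mon (row i W) t = 1].
Proof.
move=> pchar0 v0 vW; exists (\row_j 2%:R ^ v 0 j).
have two0 : 2%:R != 0 :> F by rewrite ((pcharf0P F).1 pchar0).
split=> [j||i]; first by rewrite mxE expfz_neq0.
  apply: contra v0 => /eqP/rowP t1; apply/eqP/rowP => j; rewrite mxE.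
  by have := t1 j; rewrite !mxE; apply: expz_nat_eq1.
have := congr1 (fun M : 'rV_m => M 0 i) vW; rewrite !mxE => vWi.
rewrite -[RHS](expr0z (2%:R : F)) -vWi.
rewrite (big_morph (fun k : int => (2%:R : F) ^ k) (id1 := 1) (op1 := *%R)).
- by apply: eq_bigr => j _; rewrite !mxE exprz_exp.
- by move=> x y; rewrite expfzDr.
- by rewrite expr0z.
Qed.

(** A character is a representation of size 1, and two nonzero idempotents of size 1 are never
    orthogonal, so exactly one weight occurs. *)
Lemma torus_character (F : fieldType) d (chi : 'rV[F]_d -> F) :
  [pchar F] =i pred0 -> laurent (chi : 'rV[F]_d -> F^o) -> chi (const_mx 1) = 1 ->
  (forall s t, nonzero s -> nonzero t -> chi (rmul s t) = chi s * chi t) ->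
  exists w, forall t, nonzero t -> chi t = mon w t.
Proof.
move=> pchar0 lchi chi1 chiM.
have [||m [W [E [E0 Ei Eo EE]]]] :=
    @torus_rep_weights F d pchar0 1%N (fun t => chi t *: 1%:M).
- exact: laurentZ.
- by move=> s t s0 t0; rewrite chiM // -scalemxAl mul1mx scalerA.
have entry t : nonzero t -> chi t = \sum_i mon (row i W) t * E i 0 0.
  move=> t0; have := congr1 (fun M : 'M_1 => M 0 0) (EE t t0).
  rewrite summxE !mxE mulr1 => ->; apply: eq_bigr => i _.
  by rewrite mxE.
have Eval i : E i 0 0 = 1.
  have e0 : E i 0 0 != 0.
    apply: contra (E0 i) => /eqP e0; apply/eqP/matrixP => a b.
    by rewrite !ord1 e0 mxE.
  have := congr1 (fun M : 'M_1 => M 0 0) (Ei i); rewrite mxE big_ord1.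
  by move/(canRL (mulfK e0)); rewrite mulfV.
have one_idx (i j : 'I_m) : i = j.
  apply/eqP; apply: contraT => /Eo /matrixP /(_ 0 0).
  by rewrite !mxE big_ord1 !Eval mulr1 => /eqP; rewrite oner_eq0.
case: m W E E0 Ei Eo EE entry Eval one_idx => [|m] W E _ _ _ _ entry Eval one_idx.
  have := entry _ (@nonzero1 F d); rewrite chi1 big_ord0 => /eqP.
  by rewrite oner_eq0.
exists (row ord0 W) => t t0; rewrite entry // (bigD1 ord0) //= Eval mulr1.
by rewrite big1 ?addr0 // => i; rewrite (one_idx i ord0) eqxx.
Qed.

Section Tori.
Variables (F : closedFieldType) (n : nat).
Hypothesis pchar0 : [pchar F] =i pred0.

Lemma torus_param d (T : set 'M[F]_n) : torus_of_dim d T ->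
  exists (f : 'M[F]_(d + d) -> 'M[F]_n) (g : 'M[F]_n -> 'M[F]_(d + d)),
  [/\ mxpfun (@entries F _) f /\ mxpfun (@entries F _) g,
      forall t, nonzero t -> T (f (torus_pt t)),
      forall t, nonzero t -> g (f (torus_pt t)) = torus_pt t,
      forall A, T A -> exists2 t, nonzero t & g A = torus_pt t /\ f (g A) = A
    & forall s t, nonzero s -> nonzero t ->
        f (torus_pt (rmul s t)) = f (torus_pt s) *m f (torus_pt t)].
Proof.
move=> [_ [f [g [/polynomial_mapP hf /polynomial_mapP hg fT gT fM]]]].
have Gt t : nonzero t -> @Gm_power F d (torus_pt t) by exists t.
exists f, g; split=> // [t /Gt /fT []//|t /Gt /fT []//|A /gT [[t [t0 gA]] fgA]|].
  by exists t.
by move=> s t /Gt Gs /Gt Gt'; rewrite torus_ptM fM.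
Qed.

(** The rank condition expresses that the parametrization is injective: a nonzero vector orthogonal
    to all weights would give a second point with the same image as 1. *)
Lemma torus_rep d (T : set 'M[F]_n) : torus_of_dim d T ->
  exists m (W : 'M[int]_(m, d)) (E : 'I_m -> 'M[F]_n),
  [/\ [/\ forall i, E i != 0, forall i, E i *m E i = E i &
          forall i j, i != j -> E i *m E j = 0],
      row_full (map_mx intr W : 'M[rat]_(m, d))
    & forall t, nonzero t -> T (\sum_i mon (row i W) t *: E i)].
Proof.
move=> /torus_param [f [g [[hf hg] fT fK _ fM]]].
have [m [W [E [E0 Ei Eo fE]]]] := torus_rep_weights pchar0 (laurent_mxpfun hf) fM.
exists m, W, E; split=> // [|t t0]; last by rewrite -fE //; apply: fT.
rewrite -[row_full _]/(\rank _ == d) eqn_leq rank_leq_col /= leqNgt.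
apply/negP; rewrite -mxrank_tr map_trmx => /int_kernel_vector [v v0 vW].
have [t [t0 /negP t1 mon1t]] := kernel_point pchar0 v0 vW; case: t1.
apply/eqP/torus_pt_inj; rewrite -(fK t t0) -(fK _ (@nonzero1 F d)); congr g.
rewrite !fE //; last exact: nonzero1.
by apply: eq_bigr => i _; rewrite mon1t mon1.
Qed.

Lemma torus_dim_le d (T : set 'M[F]_n) : torus_of_dim d T -> (d <= n)%N.
Proof.
move=> /torus_rep [m [W [E [[E0 Ei Eo] fullW _]]]].
apply: leq_trans (orthogonal_idempotents_le E0 Ei Eo).
by rewrite -(eqP fullW); apply: rank_leq_row.
Qed.

Lemma closed_root_exists (y : F) N : (0 < N)%N -> exists z, z ^+ N = y.
Proof.
move=> N0; have [z zE] := @GRing.solve_monicpoly F N (fun i => if i == 0%N then y else 0) N0.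
exists z; rewrite zE; case: N N0 {zE} => // N _.
by rewrite big_ord_recl /= mulr1 big1 ?addr0 // => i _; rewrite mul0r.
Qed.

(** Extract roots of order [\det c] of the coordinates of [y] and take monomials in them with
    exponents from [\adj c]; the product [c *m \adj c] is the scalar [\det c]. *)
Lemma monomial_surj d (c : 'M[int]_d) (y : 'rV[F]_d) : \det c != 0 -> nonzero y ->
  exists2 t, nonzero t & forall i, mon (row i c) t = y 0 i.
Proof.
move=> c0 y0; have N0 : (0 < `|\det c|)%N by rewrite absz_gt0.
have /choice [z zE] : forall i, exists z, z ^ \det c = y 0 i.
  move=> i; have [z zE] := closed_root_exists (y 0 i) N0.
  case: (\det c) zE => k /=; first by exists z.
  by move=> zE; exists z^-1; rewrite NegzE -exprnN exprVn invrK.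
have z0 i : z i != 0.
  apply: contra (y0 i) => /eqP zi; rewrite -zE zi exp0rz (negPf c0).
  exact: eqxx.
pose Z : 'rV[F]_d := \row_i z i.
have nzZ : nonzero Z by move=> i; rewrite mxE.
pose t : 'rV[F]_d := \row_j mon (row j (\adj c)) Z.
have t0 : nonzero t by move=> j; rewrite mxE mon_neq0.
exists t => // i.
have -> : mon (row i c) t = \prod_j mon (row j (\adj c)) Z ^ (row i c) 0 j.
  by apply: eq_bigr => j _; rewrite mxE.
rewrite -mon_mul // -row_mul mul_mx_adj /mon (bigD1 i) //= !mxE eqxx mulr1n zE.
rewrite big1 ?mulr1 // => j ji; rewrite !mxE eq_sym (negPf ji) mulr0n.
exact: expr0z.
Qed.

(* An injective morphism of tori is monomial, given by an integer matrix of full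
   column rank; a square one is onto because the field is closed under roots. *)
Lemma subtorus_dim a b (S T : set 'M[F]_n) :
  torus_of_dim a S -> torus_of_dim b T -> S `<=` T ->
  (a <= b)%N /\ (a = b -> S = T).
Proof.
move=> /torus_param [f [g [[hf hg] fS fK gS fM]]].
move=> /torus_param [f' [g' [[hf' hg'] fT fK' gT fM']]] ST.
pose phi t := f (torus_pt t).
(* The inclusion of [S] in [T] in torus coordinates, which sit in the first half of the diagonal. *)
pose u t : 'rV[F]_b := \row_i g' (phi t) (lshift b i) (lshift b i).
have [nzu phiu] : (forall t, nonzero t -> nonzero (u t)) /\
    (forall t, nonzero t -> phi t = f' (torus_pt (u t))).
  have uE t : nonzero t -> exists2 v, nonzero v & u t = v /\ phi t = f' (torus_pt v).
    move=> t0; have [v v0 [gv fv]] := gT _ (ST _ (fS t t0)); exists v => //.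
    split; last by rewrite -gv fv.
    by apply/rowP => i; rewrite mxE /phi gv mxE eqxx mulr1n row_mxEl.
  by split=> t /uE [v v0 [-> //]].
have uM s t : nonzero s -> nonzero t -> u (rmul s t) = rmul (u s) (u t).
  move=> s0 t0; have st0 := nonzero_rmul s0 t0; apply: torus_pt_inj.
  rewrite -(fK' _ (nzu _ st0)) -phiu // /phi fM // -!/(phi _) !phiu //.
  by rewrite -fM' ?fK' //; try apply: nonzero_rmul; apply: nzu.
have n1 := @nonzero1 F a.
have u1 : u (const_mx 1) = const_mx 1.
  have := uM _ _ n1 n1.
  have -> : rmul (const_mx 1) (const_mx 1) = const_mx 1 :> 'rV[F]_a.
    by apply/rowP => j; rewrite !mxE mulr1.
  move=> /rowP uu; apply/rowP => i; have := uu i; rewrite [RHS]mxE.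
  move/esym/(canRL (mulfK (nzu _ n1 i))).
  by rewrite mulfV ?nzu // => ->; rewrite mxE.
have /choice [c cE] : forall i, exists w, forall t, nonzero t -> u t 0 i = mon w t.
  move=> i; apply: torus_character => // [||s t s0 t0].
  - apply: eq_laurent (laurent_pfun (mxpfun_entries (hg' (lshift b i) (lshift b i)) hf)).
    by move=> t _; rewrite mxE.
  - by rewrite u1 mxE.
  - by rewrite uM // mxE.
pose C := \matrix_i c i.
have monC t i : nonzero t -> mon (row i C) t = u t 0 i.
  by move=> t0; rewrite rowK -cE.
have fullC : (a <= \rank (map_mx intr C^T : 'M[rat]_(a, b)))%N.
  rewrite leqNgt; apply/negP => /int_kernel_vector [v v0 vC].
  have [t [t0 /negP t1 mon1t]] := kernel_point pchar0 v0 vC; case: t1.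
  have ut : u t = u (const_mx 1).
    by rewrite u1; apply/rowP => i; rewrite -monC // mon1t mxE.
  apply/eqP/torus_pt_inj; rewrite -(fK t t0) -(fK _ n1); congr g.
  by rewrite -!/(phi _) !phiu // ut.
split=> [|ab]; first exact: leq_trans fullC (rank_leq_col _).
subst b.
apply/seteqP; split=> // A TA; have [y y0 [gA fgA]] := gT A TA.
have detC : \det C != 0.
  apply: contraTneq fullC => detC; rewrite -ltnNge ltn_neqAle rank_leq_row.
  rewrite andbT -/(row_free _) row_free_unit unitmxE det_map_mx det_tr detC.
  by rewrite rmorph0 unitr0.
have [t t0 tE] := monomial_surj detC y0.
have uty : u t = y by apply/rowP => i; rewrite -monC.
by rewrite -fgA gA -uty -phiu //; apply: fS.
Qed.

(** A torus of largest dimension in [G] is maximal, because an inclusion of tori of equal dimension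
    is an equality. It need not contain [S]. *)
Lemma maximal_torus_above d (S G : set 'M[F]_n) : torus_of_dim d S -> S `<=` G ->
  exists e T, [/\ (d <= e <= n)%N, maximal_torus G T & torus_of_dim e T].
Proof.
move=> hS SG.
pose good e := `[< exists T, torus_of_dim e T /\ T `<=` G >].
have exg : exists e, good e by exists d; apply/asboolP; exists S.
have bnd e : good e -> (e <= n)%N by case/asboolP => T [/torus_dim_le].
case: (ex_maxnP exg bnd) => e ge emax; have [T [hT TG]] := asboolW ge.
exists e, T; split=> //; first by rewrite bnd // emax //; apply/asboolP; exists S.
split=> // [|T' [e' hT'] T'G TT']; first by exists e.
have [ee' eqTT'] := subtorus_dim hT hT' TT'.
apply/esym/eqTT'/eqP; rewrite eqn_leq ee' emax //.
by apply/asboolP; exists T'.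
Qed.
End Tori.

Lemma torus_dim_le_rank (R : realType) n (G : set 'M[R]_n) d (S : set 'M[R[i]]_n) :
  torus_of_dim d S -> S `<=` complexification G -> (d <= rank G)%N.
Proof.
move=> hS SG; have pchar0 : [pchar R[i]] =i pred0 by apply: pchar_num.
have [e [T [/andP [de en] maxT hT]]] := maximal_torus_above pchar0 hS SG.
apply: leq_trans de _; have en1 : (e < n.+1)%N by rewrite ltnS.
apply: (@leq_bigmax_cond _ _ (fun d : 'I_n.+1 => nat_of_ord d) (Ordinal en1)).
by apply/asboolP; exists T.
Qed.

(** * Eigenvalue relations on groups of small rank *)

Lemma root_char_poly_neq0 (F : fieldType) n (A : 'M[F]_n) x :
  \det A = 1 -> root (char_poly A) x -> x != 0.
Proof.
move=> detA; apply: contraTneq => ->; rewrite /root horner_coef0 char_poly_det.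
by rewrite detA mulr1 signr_eq0.
Qed.

Section TorusOfElement.
Variables (F : closedFieldType) (n : nat) (S : set 'M[F]_n.+1).
Hypothesis SLS : forall B, S B -> \det B = 1.
Hypothesis SX : forall B k, S B -> S (B ^+ k).

Lemma geometric_spectral (h E : 'M[F]_n.+1) mu e a b :
  (h - mu%:M) ^+ e * E = 0 -> geometric mu (fun k => (h ^+ k * E) a b).
Proof.
move=> hE; exists e; have itE j : iter j (shift_sub mu) (fun k => (h ^+ k * E) a b) =
    fun k => (h ^+ k * ((h - mu%:M) ^+ j * E)) a b.
  elim: j => [|j IHj] /=; first by apply/funext => k; rewrite mul1r.
  rewrite IHj; apply/funext => k; rewrite /shift_sub.
  rewrite [(h - _) ^+ j.+1]exprS -mulrA; set M := _ ^+ j * E.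
  rewrite mulrBl mulrBr mulrA -exprSr.
  have -> : mu%:M * M = mu *: M by exact: mul_scalar_mx.
  rewrite -scalerAr; move: (h ^+ k.+1 * M) (h ^+ k * M) => P Q.
  by rewrite !mxE.
by rewrite itE; apply/funext => k; rewrite hE mulr0 mxE.
Qed.

(** A polynomial [f] vanishing on [S] vanishes at all powers of [h]. Since [h ^+ k] is the sum of
    the [h ^+ k * E i], whose entries are exponential with base [mu i], the twist of the zero
    sequence of these values is the value of [f] at the weight matrix, and [relW] makes it
    vanish. *)
Lemma weight_mx_closure h m d (mu : 'I_m -> F) (E : 'I_m -> 'M[F]_n.+1)
    (W : 'M[int]_(m, d)) t e :
  zariski_closure S h -> \sum_i E i = 1 -> (forall i, mu i != 0) ->
  (forall i, (h - (mu i)%:M) ^+ e * E i = 0) ->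
  (forall x : 'rV[int]_m, mon x (\row_i mu i) = 1 -> x *m W = 0) ->
  nonzero t -> zariski_closure S (weight_mx E W t).
Proof.
move=> /zariski_closureP clh E1 mu0 hE relW t0; apply/zariski_closureP => f hf fS.
(* The polynomial [A |-> f (A ^+ k)] vanishes on [S], which is stable under powers, hence at [h]. *)
have fhk k : f (h ^+ k) = 0.
  apply: (clh (fun A => f (A ^+ k))) => [|B /SX SB]; last exact: fS.
  exact: mxpfun_entries hf (mxpfunX k (@mxpfun_id F n.+1)).
have [p fp] := hf; pose phi i := mon (row i W) t.
apply: (@twist0 F m mu phi).
  have nzmu : nonzero (\row_i mu i) by move=> i; rewrite mxE.
  move=> x y; pose z : 'rV[int]_m := \row_i ((x i)%:Z - (y i)%:Z).
  have zE (u : 'I_m -> F) : (forall i, u i != 0) ->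
      \prod_i u i ^ z 0 i = (\prod_i u i ^+ x i) / \prod_i u i ^+ y i.
    move=> u0; rewrite -prodf_div; apply: eq_bigr => i _.
    by rewrite mxE expfzDr // -exprnN.
  have prod0 (u : 'I_m -> F) (w : 'I_m -> nat) :
      (forall i, u i != 0) -> \prod_i u i ^+ w i != 0.
    by move=> u0; apply/prodf_neq0 => i _; rewrite expf_neq0.
  have phi0 i : phi i != 0 by apply: mon_neq0.
  move=> muxy; have := relW z; have -> : mon z (\row_i mu i) = 1.
    rewrite /mon; under eq_bigr do rewrite [(\row__ _) _ _]mxE.
    by rewrite zE // muxy mulfV ?prod0.
  move=> /(_ erefl) zW; have := mon_mul z W t0; rewrite zW mon0 zE //.
  by move/esym/(canRL (mulfVK (prod0 _ _ phi0))); rewrite mul1r.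
rewrite fp; rewrite (_ : (fun _ => 0) = fun k => p.@[fun i => entries (h ^+ k) i]).
  apply: twist_meval => i; case/mxvec_indexP: i => a b.
  exists 'I_m, (fun i l => (i == l) : nat), (fun i k => (h ^+ k * E i) a b).
  have prod1 (u : 'I_m -> F) i : \prod_l u l ^+ (i == l) = u i.
    rewrite (bigD1 i) //= eqxx expr1 big1 ?mulr1 // => l.
    by rewrite eq_sym => /negPf ->.
  split=> [i|k|].
  - by rewrite prod1; apply: geometric_spectral (hE i).
  - by rewrite /entries mxvecE -{1}[h ^+ k]mulr1 -E1 mulr_sumr summxE.
  - rewrite /entries mxvecE summxE; apply: eq_bigr => i _.
    by rewrite mxE prod1 mul1r.
by apply/funext => k; rewrite -fp fhk.
Qed.

(** The exponents of the eigenvalues modulo the saturated lattice of multiplicative relations form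
    the weight lattice of the torus. Saturation makes this quotient free, of rank [e]. *)
Lemma torus_of_element d (h : 'M[F]_n.+1) (lam : 'rV[F]_d) :
  zariski_closure S h -> (forall j, root (char_poly h) (lam 0 j)) ->
  (forall x, mon x lam = 1 -> x = 0) ->
  exists e T, [/\ (d <= e)%N, torus_of_dim e T & T `<=` zariski_closure S].
Proof.
move=> clh rootlam indlam.
have det_cl A : zariski_closure S A -> \det A = 1.
  move=> /zariski_closureP clA; apply/eqP; rewrite -subr_eq0; apply/eqP.
  apply: (clA (fun B => \det B - 1)) => [|B /SLS ->]; last by rewrite subrr.
  by apply: pfunB (pfun_cst _ _); apply/pfun_det/mxpfun_id.
have [m [mu [E [inj_mu mu_root [E1 Ei Eo E0] hE]]]] := spectral_idempotents h.
have uh : h \in unitmx by rewrite unitmxE det_cl // unitr1.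
have mu0 i : mu i != 0.
  apply: contra (E0 i) => /eqP mui; have := hE i; rewrite mui.
  have -> : (0 : F)%:M = 0 :> 'M_n.+1 by rewrite raddf0.
  rewrite subr0 => hE0; rewrite -[E i]mul1r -(mulVr (unitrX n.+1 (uh : h \is a GRing.unit))).
  by rewrite -mulrA hE0 mulr0.
have nzmu : nonzero (\row_i mu i) by move=> i; rewrite mxE.
have /choice [pos posE] : forall j, exists i, mu i = lam 0 j.
  by move=> j; apply/mu_root/rootlam.
pose Rel (x : 'rV[int]_m) := mon x (\row_i mu i) = 1.
have [||e [W [C [CW relW Wrel]]]] := @saturated_quotient m Rel.
- exact: mon0.
- move=> x y Rx Ry; rewrite /Rel monD // -scaleN1r monZ Rx Ry.
  by rewrite mul1r exp1rz.
have mxE1 : \sum_i E i = 1%:M := E1.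
have inT t : nonzero t -> zariski_closure S (weight_mx E W t).
  by move=> t0; apply: (weight_mx_closure clh E1 mu0 hE).
exists e, (weight_torus E W); split; last by move=> _ [t t0 ->]; apply: inT.
- rewrite leqNgt; apply/negP => ed.
  (* [J] picks the given eigenvalues among the [mu]. If [e < d], some nonzero combination of them
     has weight 0, and a multiple of it is a relation against the independence of [lam]. *)
  pose J : 'M[int]_(d, m) := \matrix_j delta_mx 0 (pos j).
  have [|v v0 vJW] := @int_kernel_vector d e (J *m W).
    exact: leq_ltn_trans (rank_leq_col _) ed.
  rewrite mulmxA in vJW; have [c c0] := Wrel _ vJW.
  rewrite /Rel scalemxAl mon_mul // => relv.
  have /eqP : c *: v = 0.
    apply: indlam; rewrite -[RHS]relv; apply: eq_bigr => j _.
    by rewrite rowK mon_delta [(\row_i mu i) _ _]mxE posE.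
  by move/eqP/(scale_intmx_eq0 c0)/eqP; apply/negP.
- apply: (weight_torus_of_dim mxE1 Ei Eo E0 CW) => t t0.
  exact/det_cl/inT.
Qed.
End TorusOfElement.

(** * Multiplicative relations between eigenvalues as polynomials *)

Section RelationPolynomials.
Variables (F : fieldType) (N d : nat) (pos : 'I_d -> 'I_N).

(** A monomial relation with its negative exponents moved to the other side. The trivial relation
    gets 1 instead of 0, so that at nonzero values nonvanishing for all [m] means multiplicative
    independence. *)
Definition relation_poly (m : 'rV[int]_d) : {mpoly F[N]} :=
  if m == 0 then 1 else
  \prod_j 'X_(pos j) ^+ posz_part (m 0 j) - \prod_j 'X_(pos j) ^+ negz_part (m 0 j).

Definition relations_poly (ms : seq 'rV[int]_d) : {mpoly F[N]} :=
  \prod_(m <- ms) relation_poly m.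

Lemma relation_poly_neq0 m (v : 'I_N -> F) : (forall j, v (pos j) != 0) ->
  (relation_poly m).@[v] != 0 <-> (mon m (\row_j v (pos j)) = 1 -> m = 0).
Proof.
move=> v0; rewrite /relation_poly; have [->|m0] := eqVneq m 0.
  by rewrite meval1 oner_eq0; split.
have evalE (e : 'I_d -> nat) :
    (\prod_j 'X_(pos j) ^+ e j : {mpoly F[N]}).@[v] = \prod_j v (pos j) ^+ e j.
  by rewrite rmorph_prod; apply: eq_bigr => j _; rewrite rmorphXn /= mevalXU.
have prod0 (e : 'I_d -> nat) : \prod_j v (pos j) ^+ e j != 0.
  by apply/prodf_neq0 => j _; rewrite expf_neq0.
have -> : mon m (\row_j v (pos j)) =
    (\prod_j v (pos j) ^+ posz_part (m 0 j)) /
    \prod_j v (pos j) ^+ negz_part (m 0 j).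
  rewrite mon_parts => [|j]; last by rewrite mxE.
  by congr (_ / _); apply: eq_bigr => j _; rewrite mxE.
rewrite mevalB !evalE subr_eq0; split=> [ne|h].
  by move/(canRL (mulfVK (prod0 _))); rewrite mul1r => /eqP; rewrite (negPf ne).
by apply: contra m0 => /eqP ab; apply/eqP/h; rewrite ab mulfV.
Qed.

Lemma relations_poly_cat ms ms' :
  relations_poly (ms ++ ms') = relations_poly ms * relations_poly ms'.
Proof. exact: big_cat. Qed.

Lemma relations_poly_neq0 ms (v : 'I_N -> F) : (forall j, v (pos j) != 0) ->
  (forall m, mon m (\row_j v (pos j)) = 1 -> m = 0) ->
  (relations_poly ms).@[v] != 0.
Proof.
move=> v0 ind; rewrite rmorph_prod; elim/big_rec: _ => [|m x _ x0].
  exact: oner_neq0.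
by rewrite mulf_neq0 //; apply/relation_poly_neq0 => //; apply: ind.
Qed.

End RelationPolynomials.

(** The countable Nullstellensatz is applied to pairs of a matrix in [S] and a list of its
    eigenvalues, with the countably many [relations_poly] as inequations. If none of them vanished
    on all pairs, there would be a matrix in the closure of [S] with [d] independent eigenvalues. *)
Lemma bounded_relations (F : closedFieldType) n d (dn : (d <= n)%N)
    (S : set 'M[F]_n) : ~~ countable [set: F] -> (forall B, S B -> \det B = 1) ->
  (forall (h : 'M[F]_n) (lam : 'rV[F]_d), zariski_closure S h ->
     (forall j, root (char_poly h) (lam 0 j)) ->
     exists2 m, mon m lam = 1 & m != 0) ->
  exists ms, forall B (l : n.-tuple F), S B ->
    char_poly B = \prod_(x <- l) ('X - x%:P) ->
    (relations_poly F (widen_ord dn) ms).@[tnth l] = 0.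
Proof.
move=> Func SLS no_ind; apply: contrapT => /forallNP noms.
pose X := ('M[F]_n * n.-tuple F)%type; pose N := (n * n + n)%N.
pose pt (x : X) (k : 'I_N) : F := match fintype.split k with
  | inl a => entries x.1 a | inr j => tnth x.2 j end.
have ptl x a : pt x (lshift n a) = entries x.1 a.
  by rewrite /pt; case: split_ordP => j /eqP; rewrite (eq_lshift, eq_lrshift) // => /eqP ->.
have ptr x j : pt x (rshift (n * n) j) = tnth x.2 j.
  by rewrite /pt; case: split_ordP => i /eqP; rewrite (eq_rshift, eq_rlshift) // => /eqP ->.
pose good (x : X) := S x.1 /\ char_poly x.1 = \prod_(y <- x.2) ('X - y%:P).
pose I : set {mpoly F[N]} := [set p | forall x, good x -> p.@[pt x] = 0].
pose pos j := rshift (n * n) (widen_ord dn j).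
have relE ms x : (relations_poly F pos ms).@[pt x] =
    (relations_poly F (widen_ord dn) ms).@[tnth x.2].
  rewrite !rmorph_prod; apply: eq_bigr => m _ /=; rewrite /relation_poly.
  have [_|_] := eqVneq m 0; first by rewrite !meval1.
  by rewrite !mevalB !rmorph_prod; congr (_ - _); apply: eq_bigr => j _;
    rewrite !rmorphXn /= !mevalXU ptr.
have [||||a [Ia sa]] := @countable_nullstellensatz F N Func I _
    (relations_poly F pos).
- split.
  + by move=> x _; rewrite meval0.
  + by move=> p q Ip Iq x gx; rewrite mevalD Ip // Iq // addr0.
  + by move=> p q Iq x gx; rewrite mevalM Iq // mulr0.
- by exists [::]; rewrite /relations_poly big_nil.
- by move=> ms ms'; exists (ms ++ ms'); apply: relations_poly_cat.
- move=> ms Ims; apply: (noms ms) => B l SB Bl.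
  by rewrite -(relE ms (B, l)); apply: Ims.
(* Polynomial conditions valid on all good pairs pass to the point [a]. They place its matrix in the
   closure of [S] and make its list the eigenvalues of that matrix. *)
have vanish f : pfun pt f -> (forall x, good x -> f x = 0) ->
    forall x, pt x =1 a -> f x = 0.
  move=> [p fp] fg x xa; rewrite fp (@meval_eq _ _ _ _ p xa); apply: Ia => y gy.
  by rewrite -fp fg.
pose A : 'M[F]_n := vec_mx (\row_k a (lshift n k)).
pose l : n.-tuple F := [tuple a (rshift (n * n) j) | j < n].
have Ala : pt (A, l) =1 a.
  move=> k; case: (split_ordP k) => j ->.
    by rewrite ptl /entries /= vec_mxK mxE.
  by rewrite ptr tnth_mktuple.
have pfst : mxpfun pt (fun x : X => x.1).
  move=> i j; apply: eq_pfun (pfun_coord pt (lshift n (mxvec_index i j))) => x.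
  by rewrite ptl /entries mxvecE.
have psnd j : pfun pt (fun x : X => tnth x.2 j).
  by apply: eq_pfun (pfun_coord pt (rshift (n * n) j)) => x; rewrite ptr.
have clA : zariski_closure S A.
  apply/zariski_closureP => f hf fS.
  apply: (vanish (fun x : X => f x.1) _ _ (A, l)) => //; last by move=> x [/fS].
  exact: mxpfun_entries hf pfst.
have charA : char_poly A = \prod_(x <- l) ('X - x%:P).
  apply/polyP => k; apply/eqP; rewrite -subr_eq0; apply/eqP.
  apply: (vanish (fun x : X => (char_poly x.1)`_k -
      (\prod_(y <- x.2) ('X - y%:P))`_k) _ _ (A, l)) => //; last first.
    by move=> x [_ ->]; rewrite subrr.
  apply: pfunB; first exact: ppfun_char_poly.
  apply: (@eq_pfun _ _ _ _ _ (fun x : X => (\prod_(j < n) ('X - (tnth x.2 j)%:P))`_k)).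
    by move=> x; rewrite big_tuple.
  move: k; apply: ppfun_prod => j k.
  apply: (@eq_pfun _ _ _ _ _ (fun x : X => 'X`_k - tnth x.2 j *+ (k == 0))).
    by move=> x; rewrite coefB coefC; case: (k == 0%N).
  apply: pfunB; first exact: pfun_cst.
  by case: (k == 0%N); [apply: psnd | apply: pfun_cst].
have detA : \det A = 1.
  apply/eqP; rewrite -subr_eq0; apply/eqP; move/zariski_closureP: clA => clA.
  apply: (clA (fun B => \det B - 1)) => [|B /SLS ->]; last by rewrite subrr.
  by apply: pfunB (pfun_cst _ _); apply/pfun_det/mxpfun_id.
have rootA j : root (char_poly A) (tnth l j).
  by rewrite charA root_prod_XsubC mem_tnth.
have a_pos j : a (pos j) = tnth l (widen_ord dn j) by rewrite tnth_mktuple.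
have [|m m1] := no_ind A (\row_j a (pos j)) clA.
  by move=> j; rewrite mxE a_pos.
apply/negP; rewrite negbK; have := sa [:: m]; rewrite /relations_poly big_seq1.
move/relation_poly_neq0 => /(_ _ m1) -> // j.
by rewrite a_pos; apply: root_char_poly_neq0 (rootA _).
Qed.

Lemma algebraic_group_relations (R : realType) n d (G : set 'M[R]_n) :
  algebraic_group G -> forall dn : (d <= n)%N, (rank G < d)%N ->
  exists ms, forall B (l : n.-tuple R[i]), G B ->
    char_poly (map_mx (real_complex R) B) = \prod_(x <- l) ('X - x%:P) ->
    (relations_poly R[i] (widen_ord dn) ms).@[tnth l] = 0.
Proof.
case: n G => [|n] G [GSL [_ G1 GM _] _] dn rd.
  by move: dn rd; case: d.
pose S := map_mx (real_complex R) @` G.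
have SLS B : S B -> \det B = 1.
  by case=> A GA <-; rewrite det_map_mx (GSL A GA) rmorph1.
have SX B k : S B -> S (B ^+ k).
  case=> A GA <-; exists (A ^+ k); last by rewrite rmorphXn.
  by elim: k => [|k IHk]; [exact: G1 | rewrite exprS; apply: GM].
have [|ms msP] := bounded_relations dn (complex_uncountable R) SLS.
  move=> h lam clh rootlam; apply: contrapT => /forall2NP noind.
  have [|e [T [de hT TS]]] := torus_of_element SLS SX clh rootlam.
    by move=> x x1; have [//|/negP] := noind x; rewrite negbK => /eqP.
  have : (e <= rank G)%N.
    by apply: torus_dim_le_rank hT _; rewrite complexificationE.
  by rewrite leqNgt (leq_trans rd de).
by exists ms => B l GB; apply: msP; exists B.
Qed.

(** * Conclusion *)

Lemma meval_msym (F : comNzRingType) n (p : {mpoly F[n]}) (s : 'S_n) v :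
  (msym s p).@[v] = p.@[fun i => v (s i)].
Proof.
elim/mpoly_ring_ind: p => [c|i|p q hp hq|p q hp hq].
- by rewrite -[c%:MP]mulr1 mul_mpolyC msymZ msym1 !mevalZ !meval1.
- by rewrite /msym mmapX mmap1U !mevalXU.
- by rewrite msymD !mevalD hp hq.
- by rewrite msymM !mevalM hp hq.
Qed.

Lemma symmetrization_symmetric (F : comNzRingType) n (p : {mpoly F[n]}) :
  \sum_(s : 'S_n) msym s p \is symmetric.
Proof.
apply/issymP => t; rewrite raddf_sum [RHS](reindex_inj (mulIg t)) /=.
by apply: eq_bigr => s _; rewrite msymMm.
Qed.

(* The condition is carried by the symmetrization of [p * prod (p - x)], where
   [x] runs over the values other than [p l] taken by [p] on reorderings of [l]:
   at [A] the nonzero terms of the sum are all equal. *)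
Lemma eigenvalue_polynomial_closure (F : closedFieldType) n (p : {mpoly F[n]})
    (S : set 'M[F]_n) : [pchar F] =i pred0 ->
  (forall B (l : n.-tuple F), S B ->
     char_poly B = \prod_(x <- l) ('X - x%:P) -> p.@[tnth l] = 0) ->
  forall A (l : n.-tuple F), zariski_closure S A ->
    char_poly A = \prod_(x <- l) ('X - x%:P) -> p.@[tnth l] = 0.
Proof.
move=> pchar0 pS A l clA Al; apply/eqP; apply: contraT => pl0.
pose val (s : 'S_n) := p.@[fun i : 'I_n => tnth l (s i)].
pose vs := [seq x <- [seq val s | s : 'S_n] | (x != p.@[tnth l])].
pose q := p * \prod_(x <- vs) (p - x%:MP).
have qE v : q.@[v] = p.@[v] * \prod_(x <- vs) (p.@[v] - x).
  rewrite mevalM rmorph_prod; congr (_ * _); apply: eq_bigr => x _.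
  by rewrite /= mevalB mevalC.
have [U hU UE] := symmetric_char_poly (symmetrization_symmetric q).
have uE (k : n.-tuple F) : (\sum_(s : 'S_n) msym s q).@[tnth k] =
    \sum_(s : 'S_n) q.@[fun i => tnth k (s i)].
  by rewrite raddf_sum; apply: eq_bigr => s _ /=; rewrite meval_msym.
have UA : U A = 0.
  move/zariski_closureP: clA; apply=> // B SB.
  have [k Bk] := char_poly_roots B; rewrite (UE _ _ Bk) uE big1 // => s _.
  pose ks := [tuple tnth k (s i) | i < n].
  have Bks : char_poly B = \prod_(x <- ks) ('X - x%:P).
    rewrite Bk !big_tuple (reindex_inj (@perm_inj _ s)) /=.
    by apply: eq_bigr => i _; rewrite tnth_mktuple.
  have -> : q.@[fun i => tnth k (s i)] = q.@[tnth ks].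
    by apply: meval_eq => i; rewrite tnth_mktuple.
  by rewrite qE (pS B) ?mul0r.
move: UA; rewrite (UE _ _ Al) uE.
pose c := q.@[tnth l].
have c0 : c != 0.
  rewrite /c qE mulf_neq0 // prodf_seq_neq0; apply/allP => x.
  by rewrite mem_filter subr_eq0 eq_sym => /andP [].
have termE (s : 'S_n) : q.@[fun i => tnth l (s i)] = c *+ (val s == p.@[tnth l]).
  rewrite qE -/(val s); case: eqP => [->|/eqP sl]; first by rewrite /c qE.
  have svs : val s \in vs.
    by rewrite mem_filter sl; apply: map_f; apply: mem_enum.
  by rewrite (big_rem _ svs) /= subrr mul0r mulr0.
under eq_bigr do rewrite termE.
(* The sum is [c] times the number of permutations that preserve the value of [p]. The identity is
   one of them, so this number is nonzero in characteristic 0. *)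
rewrite sumrMnr -mulr_natr => /eqP; rewrite mulf_eq0 (negPf c0) /=.
rewrite ((pcharf0P F).1 pchar0) sum_nat_eq0 => /forallP /(_ 1%g).
rewrite implyTb; suff -> : val 1%g = p.@[tnth l] by rewrite eqxx.
by apply: meval_eq => i; rewrite perm1.
Qed.

Lemma char_poly_similar (F : fieldType) n (g A : 'M[F]_n) : g \in unitmx ->
  char_poly (g *m A *m invmx g) = char_poly A.
Proof.
move=> ug; pose gP := map_mx (@polyC F) g.
have detg : \det gP != 0.
  by rewrite det_map_mx polyC_eq0 -unitfE -unitmxE.
apply: (mulIf detg); rewrite -det_mulmx mulrC -det_mulmx; congr determinant.
rewrite /char_poly_mx mulmxBl mulmxBr -!map_mxM mulmxKV //.
by rewrite scalar_mxC.
Qed.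

Lemma uniq_subset_perm (T : eqType) (s l : seq T) : uniq s ->
  {subset s <= l} -> exists r, perm_eq l (s ++ r).
Proof.
elim: s l => [|x s IHs] l /=; first by exists l.
move=> /andP [xs us] sl; have pl := perm_to_rem (sl x (mem_head x s)).
have [y ys|r rP] := IHs (rem x l) us.
  have := perm_mem pl y; rewrite sl ?inE ?ys ?orbT //.
  by case: eqP => [yx|//]; move: xs; rewrite -yx ys.
by exists r; rewrite (perm_trans pl) // perm_cons.
Qed.

(** At a point with independent coordinates, [d] rationally independent rows of [W] give independent
    monomials, and each is an eigenvalue with eigenvectors in the row space of its [E i]. *)
Lemma torus_independent_eigenvalues (F : closedFieldType) n d (T : set 'M[F]_n) :
  [pchar F] =i pred0 -> torus_of_dim d T -> exists2 A, T A &
  exists2 lam : 'rV[F]_d, forall j, root (char_poly A) (lam 0 j) &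
    forall w, mon w lam = 1 -> w = 0.
Proof.
move=> pchar0 /(torus_rep pchar0) [m [W [E [[E0 Ei Eo] fullW TE]]]].
have [t t0 indt] := independent_point pchar0 d.
exists (weight_mx E W t); first exact: TE.
pose f := fullrankfun fullW; pose W' := rowsub f W.
have injW' w : w *m W' = 0 -> w = 0.
  move=> wW; apply/intmx_inj/(row_free_inj (fullrowsub_free fullW)).
  rewrite map_mx0 mul0mx; have := congr1 (map_mx (intr : int -> rat)) wW.
  rewrite map_mx0 map_mxM => wW0; rewrite -[RHS]wW0; congr (_ *m _).
  by apply/matrixP => i j; rewrite !mxE.
exists (\row_j mon (row (f j) W) t) => [j|w w1].
  rewrite mxE -eigenvalue_root_char; apply/eigenvalueP.
  have /rowV0Pn [u /submxP [v uv] u0] := E0 (f j); exists u => //.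
  rewrite uv -mulmxA /weight_mx mulmx_sumr (bigD1 (f j)) //= big1 => [|i ij].
    by rewrite addr0 -scalemxAr Ei -scalemxAr.
  by rewrite -scalemxAr Eo ?scaler0 // eq_sym.
apply/injW'/indt; rewrite mon_mul // -[RHS]w1; apply: eq_bigr => j _.
rewrite mxE; congr (_ ^ _); congr (mon _ t).
by apply/rowP => k; rewrite !mxE.
Qed.

Theorem proposition1p3 (R : realType) (Gamma : groupType) (n r : nat)
    (G K : set 'M[R]_n) (rho0 : Gamma -> 'M[R]_n) (H : 'I_r -> set 'M[R]_n)
    (hGamma : finitely_generated Gamma)
    (hG : semisimple G)
    (hK : semisimple K) (hKG : K `<=` G)
    (hrhoG : forall x, G (rho0 x))
    (hrhoM : forall x y, rho0 (x * y)%g = rho0 x *m rho0 y)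
    (hrhoK : zariski_closure (range rho0) = K)
    (hH : forall i, reductive (H i))
    (hHG : forall i, H i `<` G)
    (hrank : forall i, (rank (H i) < rank K)%N) :
  exists gamma : Gamma,
    forall (g : 'M[R]_n) (i : 'I_r), G g ->
      ~ (conj_by g @` H i) (rho0 gamma).
Proof.
case: r H hH hHG hrank => [|r] H hH hHG hrank.
  by exists 1%g => g [].
have pchar0 : [pchar R[i]] =i pred0 by apply: Num.Theory.pchar_num.
pose toC := real_complex R.
have [T [d [rKd hT TK]]] : exists T d,
    [/\ rank K = d, torus_of_dim d T & T `<=` complexification K].
  (* A positive rank means that the maximum defining it runs over a nonempty family, hence is
     attained by a torus. *)
  have rK0 : (0 < rank K)%N := leq_ltn_trans (leq0n _) (hrank ord0).
  pose P := [pred d : 'I_n.+1 | `[< exists T, maximal_torus (complexification K) T /\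
                                 torus_of_dim d T >]].
  have [d Pd rE] : {d : 'I_n.+1 | d \in P & rank K = d}.
    apply: eq_bigmax_cond; apply: contraTT rK0.
    rewrite -eqn0Ngt => /eqP/card0_eq P0; rewrite -eqn0Ngt; apply/eqP.
    by apply: big_pred0 => d; have := P0 d; rewrite !inE.
  have [T [[_ TK _] hT]] := asboolW Pd.
  by exists T, (d : nat).
have dn : (d <= n)%N := torus_dim_le pchar0 hT.
have /choice [ms msP] : forall i, exists ms, forall B (l : n.-tuple R[i]), H i B ->
    char_poly (map_mx toC B) = \prod_(x <- l) ('X - x%:P) ->
    (relations_poly R[i] (widen_ord dn) ms).@[tnth l] = 0.
  move=> i; apply: algebraic_group_relations; first by case: (hH i).
  by rewrite -rKd.
apply: contrapT => /forallNP noG.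
(* One polynomial that vanishes on the eigenvalue lists of all [H i] at once, and of their
   conjugates, which have the same characteristic polynomials. *)
pose s := \prod_i relations_poly R[i] (widen_ord dn) (ms i).
have sRho B (l : n.-tuple R[i]) : (map_mx toC @` range rho0) B ->
    char_poly B = \prod_(x <- l) ('X - x%:P) -> s.@[tnth l] = 0.
  case=> _ [gamma _ <-] <- cl.
  have [g [i [Gg [A HA gA]]]] : exists g i, G g /\ (conj_by g @` H i) (rho0 gamma).
    apply: contrapT => no; apply: (noG gamma) => g i Gg gH; apply: no.
    by exists g, i.
  rewrite /s rmorph_prod (bigD1 i) //= (msP i A) ?mul0r //.
  have ug : g \in unitmx.
    by case: hG => [[_ [GU _ _ _] _] _]; apply: GU.
  rewrite -cl -gA /conj_by !map_mxM map_invmx char_poly_similar //.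
  by rewrite map_unitmx.
have [A TA [lam rootlam indlam]] := torus_independent_eigenvalues pchar0 hT.
(* Density enters here: a real polynomial vanishing on the image of [rho0] vanishes on [K], hence on
   its complexification and at [A]. *)
have clA : zariski_closure (map_mx toC @` range rho0) A.
  rewrite -complexificationE => p prho; apply: (TK A TA) => B.
  by rewrite -hrhoK; apply.
have [l Al] := char_poly_roots A.
have lam0 : nonzero lam.
  move=> j; apply: root_char_poly_neq0 (rootlam j).
  by case: hT => -[TSL _ _] _; apply: TSL.
pose es := [seq lam 0 j | j : 'I_d].
(* Two equal eigenvalues would satisfy the relation given by a difference of unit vectors. *)
have inj_lam : injective (fun j => lam 0 j).
  move=> i j lij; have /eqP : delta_mx 0 i + -1 *: delta_mx 0 j = 0 :> 'rV[int]_d.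
    by apply: indlam; rewrite monD // monZ !mon_delta lij mulfV.
  rewrite scaleN1r subr_eq0 => /eqP/rowP/(_ i).
  by rewrite !mxE !eqxx /=; case: eqP.
(* The relations test the first [d] eigenvalues of a list, so the independent ones are moved to the
   front. *)
have [||rest lP] := @uniq_subset_perm _ es l.
- by rewrite map_inj_uniq // enum_uniq.
- move=> _ /mapP [j _ ->]; have := rootlam j.
  by rewrite Al root_prod_XsubC.
have sz : size (es ++ rest) == n by rewrite -(perm_size lP) size_tuple.
pose l' := Tuple sz.
have Al' : char_poly A = \prod_(x <- l') ('X - x%:P).
  by rewrite Al; apply: perm_big.
have tnth_l' j : tnth l' (widen_ord dn j) = lam 0 j.
  rewrite (tnth_nth 0) /= nth_cat size_map size_enum_ord ltn_ord.
  by rewrite (nth_map j) ?size_enum_ord // nth_ord_enum.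
have /eqP := eigenvalue_polynomial_closure pchar0 sRho clA Al'.
apply/negP; rewrite /s rmorph_prod; apply/prodf_neq0 => i _.
apply: relations_poly_neq0 => [j|w w1]; first by rewrite tnth_l'.
apply: indlam; rewrite -[RHS]w1; congr (mon w _).
by apply/rowP => j; rewrite mxE tnth_l'.
Qed.
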